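(* Let $H$ be an infinite-dimensional complex Hilbert space, let $B(H)$ be the algebra of all bounded linear operators on $H$ with unit $I$, and let $\varepsilon>0$ be fixed. Suppose that a bijective map $\varphi: B(H)\to B(H)$ (no linearity or continuity is assumed) satisfies $$\sigma_{\varepsilon}\big((T_{1}\diamond T_{2})\circ_{\ast} T_{3}\big)=\sigma_{\varepsilon}\big((\varphi(T_{1})\diamond \varphi(T_{2}))\circ_{\ast} \varphi(T_{3})\big)\qquad\text{for all } T_{1},T_{2},T_{3}\in B(H),$$ where $T\diamond S=TS^{\ast}+S^{\ast}T$ and $T\circ_{\ast}S=TS^{\ast}-ST$ for $T,S\in B(H)$. If $\varphi(iI)$ is anti-self-adjoint (that is, $\varphi(iI)^\ast=-\varphi(iI)$), then $\varphi(I)^{2}$ is invertible and there exist a unitary operator $U\in B(H)$ and $\lambda\in\{-1,1\}$ such that either $\varphi(T)=\lambda(\varphi(I)^{2})^{-1}UTU^{\ast}$ for every $T\in B(H)$, or $\varphi(T)=\lambda(\varphi(I)^{2})^{-1}UT^{t}U^{\ast}$ for every $T\in B(H)$.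
   Context: For $T\in B(H)$, $T^\ast$ denotes the adjoint of $T$, and $T^{t}$ denotes the transpose of $T$ relative to an arbitrary but fixed orthonormal basis of $H$, i.e. $T^t=JT^\ast J$ where $J$ is the conjugate-linear map fixing each vector of that basis. $\sigma(T)$ denotes the spectrum of $T$. For fixed $\varepsilon>0$, the $\varepsilon$-pseudo spectrum of $T$ is $$\sigma_{\varepsilon}(T)=\bigcup\{\sigma(T+A): A\in B(H),\ \|A\|\le\varepsilon\}=\{\lambda\in\mathbb{C}: \|(\lambda I-T)^{-1}\|\ge \varepsilon^{-1}\},$$ with the convention $\|(\lambda I-T)^{-1}\|=\infty$ if $\lambda\in\sigma(T)$. Here $\varphi(I)^2$ is the operator square $\varphi(I)\varphi(I)$. *)

(* Defs.v *)
From HB Require Import structures.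
From mathcomp Require Import all_boot all_order all_algebra.
From mathcomp Require Import complex.
From mathcomp Require Import all_classical all_reals topology normedtype.

Set Implicit Arguments.
Unset Strict Implicit.
Unset Printing Implicit Defensive.

Import Order.TTheory GRing.Theory Num.Theory.
Import numFieldNormedType.Exports.

Local Open Scope classical_set_scope.
Local Open Scope ring_scope.

(* The inner product is linear in its first argument and conjugate-linear in
   the second one. *)
HB.mixin Record CompleteNormedModule_isHilbert (R : realType) H
    of CompleteNormedModule R[i] H := {
  hdot : {dot H for (@Num.conj R[i])};
  sqr_norm_hdot : forall x : H, `|x| ^+ 2 = hdot x x
}.

#[short(type="hilbertType")]
HB.structure Definition Hilbert (R : realType) :=
  {H of CompleteNormedModule_isHilbert R H & CompleteNormedModule R[i] H}.

Section Subsets.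
Variables (R : realType) (H : hilbertType R).
Implicit Types A B : set H.

Definition lin_span A : set H :=
  [set x | exists n (c : 'I_n -> R[i]) (v : 'I_n -> H),
    (forall i, A (v i)) /\ x = \sum_i c i *: v i].

Definition orthonormal_set B :=
  forall e f : H, B e -> B f -> hdot e f = (e == f)%:R.

Definition orthonormal_basis B :=
  orthonormal_set B /\ closure (lin_span B) = setT.

End Subsets.

Definition infinite_dimensional (R : realType) (H : hilbertType R) :=
  forall A : set H, finite_set A -> lin_span A <> setT.

Definition bounded_map (R : realType) (H : hilbertType R) (f : H -> H) :=
  exists M : R[i], forall x, `|f x| <= M * `|x|.

Record bop (R : realType) (H : hilbertType R) := Bop {
  bop_fun :> H -> H;
  bop_linear : linear bop_fun;
  bop_bounded : bounded_map bop_fun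
}.
Arguments Bop {R H} bop_fun bop_linear bop_bounded.

HB.instance Definition _ (R : realType) (H : hilbertType R) (T : bop H) :=
  GRing.isLinear.Build R[i] H H *:%R (bop_fun T) (bop_linear T).

Lemma bopP (R : realType) (H : hilbertType R) (S T : bop H) :
  (S : H -> H) =1 T -> S = T.
Proof.
case: S T => [f lf bf] [g lg bg] /= /funext fg; subst g.
by rewrite (Prop_irrelevance lf lg) (Prop_irrelevance bf bg).
Qed.

Lemma bounded_map_gt0 (R : realType) (H : hilbertType R) (f : H -> H) :
  bounded_map f -> exists2 M : R[i], 0 <= M & forall x, `|f x| <= M * `|x|.
Proof.
move=> [M fM]; exists `|M| => // x.
have Mx : 0 <= M * `|x| by apply: le_trans (fM x).
by rewrite -[`|x|]normr_id -normrM ger0_norm.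
Qed.

Section Algebra.
Variables (R : realType) (H : hilbertType R).
Implicit Types (S T : bop H) (a : R[i]).

HB.instance Definition _ := gen_eqMixin (bop H).
HB.instance Definition _ := gen_choiceMixin (bop H).

Fact zero_linear : linear (fun _ : H => 0 : H).
Proof. by move=> a x y; rewrite scaler0 addr0. Qed.
Fact zero_bounded : bounded_map (fun _ : H => 0 : H).
Proof. by exists 0 => x; rewrite normr0 mul0r. Qed.
Definition bop0 := Bop _ zero_linear zero_bounded.

Fact opp_linear T : linear (fun x => - T x).
Proof. by move=> a x y; rewrite linearP opprD scalerN. Qed.
Fact opp_bounded T : bounded_map (fun x => - T x).
Proof. by have [M TM] := bop_bounded T; exists M => x; rewrite normrN. Qed.
Definition opp_bop T := Bop _ (opp_linear T) (opp_bounded T).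

Fact add_linear S T : linear (fun x => S x + T x).
Proof. by move=> a x y; rewrite !linearP scalerDr addrACA. Qed.
Fact add_bounded S T : bounded_map (fun x => S x + T x).
Proof.
have [M SM] := bop_bounded S; have [N TN] := bop_bounded T.
exists (M + N) => x; rewrite mulrDl.
by apply: le_trans (ler_normD _ _) _; apply: lerD.
Qed.
Definition add_bop S T := Bop _ (add_linear S T) (add_bounded S T).

Fact scale_linear a T : linear (fun x => a *: T x).
Proof. by move=> b x y; rewrite linearP scalerDr !scalerA mulrC. Qed.
Fact scale_bounded a T : bounded_map (fun x => a *: T x).
Proof.
have [M TM] := bop_bounded T; exists (`|a| * M) => x.
by rewrite normrZ -mulrA ler_wpM2l.
Qed.
Definition scale_bop a T := Bop _ (scale_linear a T) (scale_bounded a T).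

Fact id_linear : linear (fun x : H => x).
Proof. by []. Qed.
Fact id_bounded : bounded_map (fun x : H => x).
Proof. by exists 1 => x; rewrite mul1r. Qed.
Definition bop1 := Bop _ id_linear id_bounded.

Fact mul_linear S T : linear (fun x => S (T x)).
Proof. by move=> a x y; rewrite !linearP. Qed.
Fact mul_bounded S T : bounded_map (fun x => S (T x)).
Proof.
have [M M0 SM] := bounded_map_gt0 (bop_bounded S).
have [N TN] := bop_bounded T.
exists (M * N) => x; apply: le_trans (SM _) _.
by rewrite -mulrA ler_wpM2l.
Qed.
Definition mul_bop S T := Bop _ (mul_linear S T) (mul_bounded S T).

Fact add_bopA : associative add_bop.
Proof. by move=> S T U; apply: bopP => x /=; rewrite addrA. Qed.
Fact add_bopC : commutative add_bop.
Proof. by move=> S T; apply: bopP => x /=; rewrite addrC. Qed.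
Fact add_bop0 : left_id bop0 add_bop.
Proof. by move=> T; apply: bopP => x /=; rewrite add0r. Qed.
Fact add_bopN : left_inverse bop0 opp_bop add_bop.
Proof. by move=> T; apply: bopP => x /=; rewrite addNr. Qed.
HB.instance Definition _ :=
  GRing.isZmodule.Build (bop H) add_bopA add_bopC add_bop0 add_bopN.

Fact mul_bopA : associative mul_bop.
Proof. by move=> S T U; apply: bopP. Qed.
Fact mul_bop1l : left_id bop1 mul_bop.
Proof. by move=> T; apply: bopP. Qed.
Fact mul_bop1r : right_id bop1 mul_bop.
Proof. by move=> T; apply: bopP. Qed.
Fact mul_bopDl : left_distributive mul_bop +%R.
Proof. by move=> S T U; apply: bopP. Qed.
Fact mul_bopDr : right_distributive mul_bop +%R.
Proof. by move=> S T U; apply: bopP => x /=; rewrite linearD. Qed.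
HB.instance Definition _ := GRing.Zmodule_isPzRing.Build (bop H)
  mul_bopA mul_bop1l mul_bop1r mul_bopDl mul_bopDr.

Fact scale_bopA a b T : scale_bop a (scale_bop b T) = scale_bop (a * b) T.
Proof. by apply: bopP => x /=; rewrite scalerA. Qed.
Fact scale_bop1 : left_id 1 scale_bop.
Proof. by move=> T; apply: bopP => x /=; rewrite scale1r. Qed.
Fact scale_bopDr : right_distributive scale_bop +%R.
Proof. by move=> a S T; apply: bopP => x /=; rewrite scalerDr. Qed.
Fact scale_bopDl T : {morph scale_bop^~ T : a b / a + b}.
Proof. by move=> a b; apply: bopP => x /=; rewrite scalerDl. Qed.
HB.instance Definition _ := GRing.Zmodule_isLmodule.Build R[i] (bop H)
  scale_bopA scale_bop1 scale_bopDr scale_bopDl.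

End Algebra.

Section Operators.
Variables (R : realType) (H : hilbertType R).
Implicit Types (S T U : bop H) (eps : R).

(* Norms in H are R[i]-valued (real and nonnegative), hence the real part. *)
Definition opnorm T : R :=
  sup [set complex.Re `|T x| | x in [set x : H | `|x| <= 1]].

Definition adjoint_of T S := forall x y, hdot (T x) y = hdot x (S y).

(* Existence of the adjoint is the Riesz representation theorem. *)
Definition adj T : bop H := xget 0 [set S | adjoint_of T S].

Definition inverse_of T S := T * S = 1 /\ S * T = 1.

Definition invertible T := exists S, inverse_of T S.

Definition unitary U := inverse_of U (adj U).

Definition spectrum T : set R[i] :=
  [set l : R[i] | ~ invertible (l *: (1 : bop H) - T)].

Definition pseudospectrum eps T : set R[i] :=
  \bigcup_(A in [set A : bop H | opnorm A <= eps]) spectrum (T + A).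

Definition diamond T S := T * adj S + adj S * T.

Definition circ_star T S := T * adj S - S * T.

End Operators.

(* For an orthonormal basis B this map exists and is unique: continuity is
   what determines it outside the algebraic span of B. *)
Record basis_conj (R : realType) (H : hilbertType R) (B : set H) := BasisConj {
  conj_fun :> H -> H;
  conj_semilinear : forall (a : R[i]) x y,
    conj_fun (a *: x + y) = a^* *: conj_fun x + conj_fun y;
  conj_bounded : bounded_map conj_fun;
  conj_fix : forall e, B e -> conj_fun e = e
}.

Section Transpose.
Variables (R : realType) (H : hilbertType R) (B : set H) (J : basis_conj B).
Implicit Type T : bop H.

Fact transpose_linear T : linear (fun x => J (adj T (J x))).
Proof.
by move=> a x y; rewrite !(conj_semilinear, linearP) conjCK.
Qed.

Fact transpose_bounded T : bounded_map (fun x => J (adj T (J x))).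
Proof.
have [M M0 JM] := bounded_map_gt0 (conj_bounded J).
have [N N0 TN] := bounded_map_gt0 (bop_bounded (adj T)).
exists (M * (N * M)) => x; apply: le_trans (JM _) _.
rewrite -!mulrA ler_wpM2l//; apply: le_trans (TN _) _.
by rewrite ler_wpM2l.
Qed.

Definition transpose T := Bop _ (transpose_linear T) (transpose_bounded T).

End Transpose.

(* Main.v *)
Require Import Defs.
From mathcomp Require Import all_boot all_order all_algebra.
From mathcomp Require Import complex.
From mathcomp Require Import all_classical all_reals topology normedtype.
From mathcomp Require Import ring lra.

Set Implicit Arguments.
Unset Strict Implicit.
Unset Printing Implicit Defensive.

Import Order.TTheory GRing.Theory Num.Theory.
Import numFieldNormedType.Exports.

Local Open Scope classical_set_scope.
Local Open Scope ring_scope.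

Local Notation "k %:C" := (real_complex _ k) : ring_scope.

(* Pseudospectra are only ever compared for operators a K with K self-adjoint,
   plus once for complex multiples of rank one projections.  For self-adjoint K
   the largest real part in the pseudospectrum is eps plus the top of the
   numerical range of K, so the endpoints of the numerical range are invariants.
   They give phi 1 = 1 and phi i = i; substituting these, the pseudospectra of
   2 (T diamond S) and of 2 (T circ_star S) are preserved too, and phi preserves
   self-adjointness.  The extreme eigenvalues of w (x) y + y (x) w determine
   Re <w, y> and the norm of the part of w orthogonal to y.  Hence phi maps each
   rank one projection P = x (x) x to a rank one projection x' (x) x',
   phi (i P) = i phi P, and |S x|^2 - (Re <S x, x>)^2 is preserved.  Finally
   (S diamond (2 P - 1)) circ_star (i P) = -4 i <S x, x> P yields
   <phi S x', x'> = <S x, x> for every S.  So phi is linear, multiplicative and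
   *-preserving, and U x = phi (x (x) e) e' implements it: the first alternative
   always holds, with phi 1 = 1 and l = 1. *)

(** * The real part of the inner product *)

Section RealDot.
Variables (R : realType) (H : hilbertType R).
Implicit Types (x y z : H) (a b : R[i]) (k : R).

Lemma hdotDl x y z : hdot (x + y) z = hdot x z + hdot y z.
Proof. exact: linearDl. Qed.
Lemma hdotDr x y z : hdot z (x + y) = hdot z x + hdot z y.
Proof. exact: linearDr. Qed.
Lemma hdotNl x y : hdot (- x) y = - hdot x y.
Proof. exact: linearNl. Qed.
Lemma hdotNr x y : hdot x (- y) = - hdot x y.
Proof. exact: linearNr. Qed.
Lemma hdotZl a x y : hdot (a *: x) y = a * hdot x y.
Proof. exact: linearZl_LR. Qed.
Lemma hdotZr a x y : hdot x (a *: y) = a^* * hdot x y.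
Proof. exact: linearZr_LR. Qed.
Lemma hdotC x y : hdot x y = (hdot y x)^*.
Proof. by rewrite hermC /= expr0 mul1r. Qed.
Lemma hdot0r x : hdot x 0 = 0.
Proof. by rewrite -(scale0r 0) hdotZr conjC0 mul0r. Qed.
Lemma hdot0l x : hdot 0 x = 0.
Proof. by rewrite -(scale0r 0) hdotZl mul0r. Qed.

(** The inner product of the underlying real Hilbert space. Since [hdot] is conjugate-linear on the
    right, [rdot x ('i *: y)] is the imaginary part of [hdot x y]; real arithmetic then suffices for
    both parts. *)
Definition rdot x y : R := complex.Re (hdot x y).
Definition nsq x : R := rdot x x.

Lemma ReD a b : complex.Re (a + b) = complex.Re a + complex.Re b.
Proof. by case: a b => [? ?] [? ?]. Qed.
Lemma ReN a : complex.Re (- a) = - complex.Re a.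
Proof. by case: a. Qed.
Lemma ReJ a : complex.Re (a^*) = complex.Re a.
Proof. by case: a. Qed.
Lemma ReZ k a : complex.Re (k%:C * a) = k * complex.Re a.
Proof. by case: a => [? ?] /=; rewrite mul0r subr0. Qed.
Lemma conj_real k : (k%:C)^* = k%:C.
Proof. by apply/eqP; rewrite eq_complex /= oppr0 !eqxx. Qed.

Lemma rdotDl x y z : rdot (x + y) z = rdot x z + rdot y z.
Proof. by rewrite /rdot hdotDl ReD. Qed.
Lemma rdotDr x y z : rdot z (x + y) = rdot z x + rdot z y.
Proof. by rewrite /rdot hdotDr ReD. Qed.
Lemma rdotNl x y : rdot (- x) y = - rdot x y.
Proof. by rewrite /rdot hdotNl ReN. Qed.
Lemma rdotNr x y : rdot x (- y) = - rdot x y.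
Proof. by rewrite /rdot hdotNr ReN. Qed.
Lemma rdotZl k x y : rdot (k%:C *: x) y = k * rdot x y.
Proof. by rewrite /rdot hdotZl ReZ. Qed.
Lemma rdotZr k x y : rdot x (k%:C *: y) = k * rdot x y.
Proof. by rewrite /rdot hdotZr conj_real ReZ. Qed.
Lemma rdotC x y : rdot x y = rdot y x.
Proof. by rewrite /rdot hdotC ReJ. Qed.
Lemma rdot0l x : rdot 0 x = 0.
Proof. by rewrite /rdot hdot0l. Qed.
Lemma rdot0r x : rdot x 0 = 0.
Proof. by rewrite /rdot hdot0r. Qed.

Definition rdotE := (rdotDl, rdotDr, rdotNl, rdotNr, rdotZl, rdotZr, rdot0l, rdot0r).

Lemma hdot_rdot x y : hdot x y = Complex (rdot x y) (rdot x ('i *: y)).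
Proof.
rewrite /rdot hdotZr conjCi; case: (hdot x y) => c d.
rewrite -complexiE /=; congr Complex; ring.
Qed.

Lemma rdot_i x y : rdot ('i *: x) ('i *: y) = rdot x y.
Proof.
  by rewrite /rdot hdotZl hdotZr conjCi mulrA mulrN -expr2 sqrCi opprK mul1r. Qed.

Lemma rdot_iC x y : rdot ('i *: x) y = - rdot x ('i *: y).
Proof.
by rewrite /rdot hdotZl hdotZr conjCi mulNr ReN opprK.
Qed.

Lemma nsqE x : hdot x x = (nsq x)%:C.
Proof.
have := rdot_iC x x; rewrite (rdotC ('i *: x)) hdot_rdot => h.
by rewrite /nsq; congr Complex; lra.
Qed.

Lemma nsq_norm x : `|x| ^+ 2 = (nsq x)%:C.
Proof. by rewrite sqr_norm_hdot nsqE. Qed.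

Lemma nsq_ge0 x : 0 <= nsq x.
Proof. by rewrite -ler0c -nsq_norm exprn_ge0. Qed.

Lemma nsq_eq0 x : nsq x = 0 -> x = 0.
Proof.
move=> h; have := nsq_norm x; rewrite h => /eqP.
by rewrite expf_eq0 /= normr_eq0 => /eqP.
Qed.

Lemma nsq0 : nsq 0 = 0. Proof. exact: rdot0l. Qed.
Lemma nsqN x : nsq (- x) = nsq x.
Proof. by rewrite /nsq !rdotE opprK. Qed.
Lemma nsqD x y : nsq (x + y) = nsq x + 2 * rdot x y + nsq y.
Proof. by rewrite /nsq !rdotE (rdotC y x); ring. Qed.
Lemma nsqB x y : nsq (x - y) = nsq x - 2 * rdot x y + nsq y.
Proof. by rewrite nsqD nsqN rdotNr; ring. Qed.
Lemma nsqZ a x : nsq (a *: x) = complex.Re (`|a| ^+ 2) * nsq x.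
Proof.
by rewrite /nsq /rdot hdotZl hdotZr mulrA -normCK -add_Re2_Im2 ReZ.
Qed.
Lemma nsqZr k x : nsq (k%:C *: x) = k ^+ 2 * nsq x.
Proof. by rewrite /nsq !rdotE; ring. Qed.

Lemma nsq_gt0 x : x != 0 -> 0 < nsq x.
Proof.
by move=> x0; rewrite lt_neqAle nsq_ge0 eq_sym andbT;
  apply: contraNneq x0 => /nsq_eq0->.
Qed.

Lemma rdot_cauchy_schwarz x y : rdot x y ^+ 2 <= nsq x * nsq y.
Proof.
have [->|y0] := eqVneq y 0; first by rewrite nsq0 rdot0r expr0n mulr0.
have := nsq_ge0 ((nsq y)%:C *: x - (rdot x y)%:C *: y).
rewrite nsqB !nsqZr !rdotE => h.
have yp := nsq_gt0 y0.
rewrite -subr_ge0 -(pmulr_rge0 _ yp); nra.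
Qed.

(** The vector [u] below is [hdot x y *: y]; the real inequality for [x] and [u] carries an extra
    factor [s] on both sides, which cancels. *)
Lemma hdot_cauchy_schwarz x y :
  rdot x y ^+ 2 + rdot x ('i *: y) ^+ 2 <= nsq x * nsq y.
Proof.
set u := (rdot x y)%:C *: y + (rdot x ('i *: y))%:C *: ('i *: y).
have iy0 : rdot y ('i *: y) = 0 by have := rdot_iC y y; rewrite rdotC; lra.
have nu : nsq u = (rdot x y ^+ 2 + rdot x ('i *: y) ^+ 2) * nsq y.
  rewrite /u nsqD !nsqZr !rdotE iy0;
    have -> : nsq ('i *: y) = nsq y by exact: rdot_i.
  by ring.
have xu : rdot x u = rdot x y ^+ 2 + rdot x ('i *: y) ^+ 2.
  by rewrite /u !rdotE; ring.
have := rdot_cauchy_schwarz x u; rewrite nu xu.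
set s := _ + _; have s0 : 0 <= s by rewrite /s addr_ge0 ?sqr_ge0.
have [->|/eqP sn0] := eqVneq s 0; first by rewrite mulr_ge0 ?nsq_ge0.
have sp : 0 < s by rewrite lt_neqAle eq_sym s0 andbT; apply/eqP.
by rewrite mulrCA expr2 ler_pM2l.
Qed.

Lemma rdot_inj x y : (forall z, rdot x z = rdot y z) -> x = y.
Proof.
move=> h; apply/eqP; rewrite -subr_eq0; apply/eqP/nsq_eq0.
by rewrite /nsq rdotDl rdotNl h subrr.
Qed.

Lemma hdot_inj x y : (forall z, hdot x z = hdot y z) -> x = y.
Proof. by move=> h; apply: rdot_inj => z; rewrite /rdot h. Qed.

Lemma norm_le_nsq x k : 0 <= k -> (`|x| <= k%:C) = (nsq x <= k ^+ 2).
Proof.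
move=> k0; rewrite -lecR -nsq_norm rmorphXn /=.
by rewrite ler_pXn2r ?nnegrE ?ler0c ?normr_ge0.
Qed.

Lemma norm_lt_nsq x k : 0 <= k -> (`|x| < k%:C) = (nsq x < k ^+ 2).
Proof.
move=> k0; rewrite -ltcR -nsq_norm rmorphXn /=.
by rewrite ltr_pXn2r ?nnegrE ?ler0c ?normr_ge0.
Qed.

End RealDot.

(** * Minimization and completeness *)

Section Minimization.
Variables (R : realType) (H : hilbertType R).
Implicit Types (x y z : H) (T : bop H).

Lemma bopD T x y : T (x + y) = T x + T y.
Proof. exact: linearD. Qed.
Lemma bopN T x : T (- x) = - T x.
Proof. exact: linearN. Qed.
Lemma bopZ T a x : T (a *: x) = a *: T x.
Proof. exact: linearZ. Qed.
Lemma bop_0 T : T 0 = 0.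
Proof. exact: linear0. Qed.

Lemma bounded_nsq (f : H -> H) : bounded_map f ->
  exists2 K : R, 0 < K & forall x, nsq (f x) <= K * nsq x.
Proof.
move=> /bounded_map_gt0[M M0 fM].
case: M M0 fM => [m mi] + fM; rewrite lecE /= => /andP[/eqP mi0 m0].
(* The summand 1 keeps the constant strictly positive even for the zero map. *)
subst mi; exists (m ^+ 2 + 1) => [|x]; first by rewrite ltr_wpDl ?sqr_ge0.
have : nsq (f x) <= m ^+ 2 * nsq x.
  rewrite -lecR rmorphM rmorphXn /= -!nsq_norm -exprMn.
  by rewrite ler_pXn2r ?nnegrE ?mulr_ge0 ?ler0c ?normr_ge0 ?fM.
by move=> /le_trans; apply; rewrite ler_wpM2r ?nsq_ge0// lerDl.
Qed.

Lemma nsq_bounded (f : H -> H) (K : R) : 0 <= K ->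
  (forall x, nsq (f x) <= K * nsq x) -> bounded_map f.
Proof.
move=> K0 fK; exists (Num.sqrt K)%:C => x.
rewrite -(@ler_pXn2r _ 2) ?nnegrE ?mulr_ge0 ?ler0c ?sqrtr_ge0 ?normr_ge0//.
by rewrite exprMn !nsq_norm -rmorphXn /= sqr_sqrtr// -rmorphM /= lecR.
Qed.

Lemma nsq_complete (u : nat -> H) :
  (forall e : R, 0 < e ->
     exists N, forall n m, (N <= n)%N -> (N <= m)%N -> nsq (u n - u m) < e) ->
  exists l, forall e : R, 0 < e ->
     exists N, forall n, (N <= n)%N -> nsq (l - u n) < e.
Proof.
move=> uC; have : cvg (u @ \oo).
  apply/cauchy_cvgP/cauchy_ballP => e; case: e => [e ei].
  rewrite ltcE /= => /andP[/eqP -> e0]; rewrite -/(e%:C).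
  have [N uN] := uC _ (exprn_gt0 2 e0).
  pose A := u @` [set n | N <= n]%N.
  exists (A, A); first by split; exists N => // n Nn; exists n.
  move=> [_ _] [/= [n Nn <-] [m Nm <-]].
  rewrite -ball_normE /= norm_lt_nsq ?ltW//.
  exact: uN.
move=> /cvg_ex[l ul]; exists l => e e0.
have e1 : 0 < (Num.sqrt e)%:C :> R[i] by rewrite ltcR sqrtr_gt0.
have /cvgrPdist_lt/(_ _ e1)[N _ uN] := ul.
exists N => n /uN; rewrite /= norm_lt_nsq ?sqrtr_ge0//.
by rewrite sqr_sqrtr// ltW.
Qed.

(* The minimum of [nsq (T x) - 2 * l x] is attained because a minimizing
   sequence is Cauchy by the parallelogram law. *)
Lemma quadratic_minimizer T (l : H -> R) (c M : R) :
  0 < c -> (forall x, c * nsq x <= nsq (T x)) ->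
  (forall k x y, l (k%:C *: x + y) = k * l x + l y) ->
  0 <= M -> (forall x, l x ^+ 2 <= M * nsq x) ->
  exists x0, forall h, rdot (T x0) (T h) = l h.
Proof.
move=> c0 Tc lL M0 lM.
have [K K0 TK] := bounded_nsq (bop_bounded T).
pose J x := nsq (T x) - 2 * l x.
have lowJ x : - (M / c) <= J x.
  have := Tc x; have := lM x; have := nsq_ge0 x; rewrite /J.
  have Mc : M / c * c = M by rewrite mulfVK// gt_eqF.
  have Mc0 : 0 <= M / c by rewrite divr_ge0// ltW.
  move: (M / c) (l x) (nsq x) (nsq (T x)) Mc Mc0 => q t s r Mc Mc0 s0 ts rs.
  suff : 2 * t <= c * s + q by lra.
  rewrite leNgt; apply/negP => tbig.
  have := sqr_ge0 (c * s - q); have : 0 <= c * s by rewrite mulr_ge0// ltW.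
  move: ts; rewrite -Mc; nra.
have infJ : has_inf (range J).
  split; first by exists (J 0), 0.
  by exists (- (M / c)) => _ [x _ <-].
pose d := inf (range J).
have Jd x : d <= J x by apply: ge_inf; [exact: infJ.2|exists x].
have [u uJ] : exists u : nat -> H, forall n, J (u n) < d + n.+1%:R^-1.
  have ex n : exists x, J x < d + n.+1%:R^-1.
    have n0 : 0 < n.+1%:R^-1 :> R by rewrite invr_gt0.
    by have [_ [x _ <-] xd] := inf_adherent n0 infJ; exists x.
  by have [u] := choice ex; exists u.
have l2 x y : l (x + y) = l x + l y by have := lL 1 x y; rewrite scale1r mul1r.
have l1 k x : l (k%:C *: x) = k * l x.
  by have := lL k x 0; have := lL 1 0 0; rewrite !addr0 scaler0; lra.
have par x y : nsq (T (x - y)) <= 2 * (J x + J y - 2 * d).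
  have := Jd (2^-1%:C *: (x + y)); rewrite /J bopZ !bopD bopN nsqZr l1 l2.
  by rewrite nsqB nsqD; lra.
have inv_lt (e : R) : 0 < e -> exists N, forall n, (N <= n)%N -> n.+1%:R^-1 < e.
  move=> e0; have [N] := ltr_add_invr e0; rewrite add0r => Ne.
  exists N => n Nn; apply: le_lt_trans Ne.
  by rewrite lef_pV2 ?posrE// ler_nat ltnS.
have [x0 ux0] : exists l, forall e : R, 0 < e ->
     exists N, forall n, (N <= n)%N -> nsq (l - u n) < e.
  apply: nsq_complete => e e0.
  have e1 : 0 < c * e / 4 by rewrite divr_gt0 ?mulr_gt0.
  have [N Ne] := inv_lt _ e1; exists N => n m /Ne ne /Ne me.
  rewrite -(ltr_pM2l c0); apply: le_lt_trans (Tc _) _.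
  apply: le_lt_trans (par _ _) _; move: (uJ n) (uJ m) ne me.
  by move: (J (u n)) (J (u m)) n.+1%:R^-1 m.+1%:R^-1 (c * e) => *; lra.
(* [g x] is half the derivative of [J] at [x] in the direction [h]. It is small along the minimizing
   sequence ([gu], by optimizing the step [t]) and continuous ([g2]), so it vanishes at [x0]. *)
exists x0 => h; pose g x := rdot (T x) (T h) - l h.
have gu n : g (u n) ^+ 2 <= nsq (T h) * n.+1%:R^-1.
  have hn : 0 < n.+1%:R^-1 :> R by rewrite invr_gt0.
  have ge t : - n.+1%:R^-1 <= t ^+ 2 * nsq (T h) + 2 * t * g (u n).
    have := Jd (t%:C *: h + u n); have := uJ n.
    rewrite /J /g bopD bopZ nsqD nsqZr rdotZl lL (rdotC (T h)).
    by move: n.+1%:R^-1 => e; lra.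
  have a0 := nsq_ge0 (T h).
  move: (nsq (T h)) (g (u n)) (n.+1%:R^-1) a0 hn ge => a b e a0 e0 ge.
  have [a0'|ap] := eqVneq a 0.
    have [->|bn] := eqVneq b 0; first by rewrite expr0n mulr_ge0// ltW.
    have := ge (- e / b); rewrite a0' mulr0 add0r -mulrA divfK//; lra.
  have aP : 0 < a by rewrite lt_neqAle eq_sym ap.
  have := ge (- b / a); rewrite -(ler_pM2l aP).
  have -> : a * ((- b / a) ^+ 2 * a + 2 * (- b / a) * b) = - b ^+ 2 by field.
  lra.
have g2 n : (g x0 - g (u n)) ^+ 2 <= K * nsq (T h) * nsq (x0 - u n).
  have -> : g x0 - g (u n) = rdot (T (x0 - u n)) (T h).
    by rewrite /g bopD bopN !rdotE; ring.
  apply: le_trans (rdot_cauchy_schwarz _ _) _.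
  by rewrite mulrAC ler_wpM2r ?nsq_ge0.
suff : g x0 = 0 by rewrite /g; lra.
have a0 := nsq_ge0 (T h).
apply/eqP/negPn/negP => gn.
have gp : 0 < g x0 ^+ 2
  by rewrite lt_neqAle sqr_ge0 andbT eq_sym expf_eq0 negb_and gn orbT.
(* This denominator makes both [(g x0 - g (u n)) ^+ 2] and [g (u n) ^+ 2] smaller than an eighth of
   [g x0 ^+ 2], contradicting the triangle inequality. *)
have D0 : 0 < 8 * (1 + nsq (T h)) * (1 + K) by rewrite !mulr_gt0//; lra.
have e0 := divr_gt0 gp D0.
have [N1 h1] := inv_lt _ e0; have [N2 h2] := ux0 _ e0.
have := h1 (maxn N1 N2) (leq_maxl _ _); have := h2 (maxn N1 N2) (leq_maxr _ _).
have := gu (maxn N1 N2); have := g2 (maxn N1 N2).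
set n := maxn N1 N2.
rewrite !ltr_pdivlMr//.
have i0 : 0 < n.+1%:R^-1 :> R by rewrite invr_gt0.
have s0 := nsq_ge0 (x0 - u n).
move: (g x0) (g (u n)) (nsq (T h)) (n.+1%:R^-1) (nsq (x0 - u n)) a0 gp i0 s0.
move=> p q a e s a0 gp e0' s0 hq hpq hs he.
have hs' : 8 * (K * a * s) < p ^+ 2.
  have : 0 <= (a + K + 1) * s by rewrite mulr_ge0 ?addr_ge0// ltW.
  lra.
have he' : 8 * (a * e) < p ^+ 2.
  have : 0 <= (1 + K + a * K) * e by rewrite mulr_ge0 ?addr_ge0 ?mulr_ge0// ltW.
  lra.
have := sqr_ge0 (p - 2 * q); nra.
Qed.

End Minimization.

(** * Adjoints, invertibility and pseudospectra *)

Section Adjoint.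
Variables (R : realType) (H : hilbertType R).
Implicit Types (x y z : H) (S T : bop H).

(** The lower bound gives injectivity, hence linearity of the chosen preimage map, and is also the
    bound of the inverse. *)
Lemma bijective_invertible T (c : R) : 0 < c ->
  (forall x, c * nsq x <= nsq (T x)) -> (forall y, exists x, T x = y) ->
  invertible T.
Proof.
move=> c0 Tc /choice[g gK].
have inj x y : T x = T y -> x = y.
  move=> Txy; apply/eqP; rewrite -subr_eq0; apply/eqP/nsq_eq0/eqP.
  rewrite eq_le nsq_ge0 andbT -(ler_pM2l c0) mulr0.
  by apply: le_trans (Tc _) _; rewrite bopD bopN Txy subrr nsq0.
have gL : linear g.
  by move=> a x y; apply: inj; rewrite bopD bopZ !gK.
have gB : bounded_map g.
  apply: (@nsq_bounded _ _ _ c^-1) => [|y]; first by rewrite invr_ge0 ltW.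
  by rewrite ler_pdivlMl// -[in leRHS](gK y).
exists (Bop _ gL gB); split; apply: bopP => x /=; first exact: gK.
by apply: inj; rewrite gK.
Qed.

(** A form of the Lax-Milgram theorem. Minimizing the distance from [y] to the range of [T] gives a
    residual orthogonal to that range; coercivity applied to the residual itself shows that it is
    zero. *)
Lemma coercive_invertible T (d : R) : 0 < d ->
  (forall x, d * nsq x <= rdot (T x) x) -> invertible T.
Proof.
move=> d0 Td.
have Tc x : d ^+ 2 * nsq x <= nsq (T x).
  have := rdot_cauchy_schwarz (T x) x; have := Td x.
  have [->|x0] := eqVneq x 0; first by move=> _ _; rewrite bop_0 nsq0 mulr0.
  have := nsq_gt0 x0; move: (nsq x) (nsq (T x)) (rdot _ _) => a b r a0 h1 h2.
  rewrite -(ler_pM2r a0); apply: le_trans h2.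
  by rewrite -mulrA -expr2 -exprMn ler_pXn2r ?nnegrE ?(le_trans _ h1)// mulr_ge0// ltW.
apply: (bijective_invertible (exprn_gt0 2 d0) Tc) => y.
have [K K0 TK] := bounded_nsq (bop_bounded T).
have [|||x0 x0P] :=
    @quadratic_minimizer _ _ T (fun h => rdot y (T h)) _ (nsq y * K) (exprn_gt0 2 d0) Tc.
- by move=> k u v; rewrite bopD bopZ !rdotE.
- by rewrite mulr_ge0 ?nsq_ge0// ltW.
- move=> x; apply: le_trans (rdot_cauchy_schwarz _ _) _.
  by rewrite -mulrA ler_wpM2l ?nsq_ge0.
exists x0; apply/eqP; rewrite -subr_eq0; apply/eqP/nsq_eq0/eqP.
rewrite eq_le nsq_ge0 andbT -(ler_pM2l d0) mulr0; apply: le_trans (Td _) _.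
by rewrite rdotC rdotDl rdotNl x0P subrr.
Qed.

(** Riesz representation is [quadratic_minimizer] for the identity operator. It is used for the real
    functional [rdot (T x) y]; replacing [x] by ['i *: x] recovers the imaginary part. *)
Lemma adjP T : adjoint_of T (adj T).
Proof.
apply: (@xgetPex _ 0 [set S | adjoint_of T S]).
have [K K0 TK] := bounded_nsq (bop_bounded T).
have ex y : exists z, forall x, rdot (T x) y = rdot x z.
  have [||||z zP] := @quadratic_minimizer _ _ 1 (fun h => rdot (T h) y) 1 (K * nsq y) ltr01.
  - by move=> x; rewrite mul1r.
  - by move=> k u v; rewrite bopD bopZ !rdotE.
  - by rewrite mulr_ge0 ?nsq_ge0// ltW.
  - move=> x; apply: le_trans (rdot_cauchy_schwarz _ _) _.
    by rewrite mulrAC ler_wpM2r ?nsq_ge0.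
  by exists z => x; rewrite -zP /= rdotC.
have [S SP] := choice ex.
have SP' x y : hdot (T x) y = hdot x (S y).
  rewrite !hdot_rdot SP; congr Complex.
  apply: oppr_inj; rewrite -rdot_iC -bopZ SP rdot_iC.
  by [].
have SL : linear S.
  move=> a x y; apply: hdot_inj => z.
  by rewrite [LHS]hdotC [RHS]hdotC -SP' hdotDr hdotZr !SP' hdotDr hdotZr.
have SB : bounded_map S.
  apply: (@nsq_bounded _ _ _ K) => [|y]; first exact: ltW.
  have := rdot_cauchy_schwarz (T (S y)) y; rewrite SP -/(nsq (S y)).
  have := TK (S y); have := nsq_ge0 y.
  have [->|n0] := eqVneq (S y) 0; first by rewrite nsq0 => y0 _ _;
    rewrite mulr_ge0// ltW.
  have := nsq_gt0 n0; move: (nsq (S y)) (nsq y) (nsq _) => s t r s0 t0 h1 h2.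
  rewrite -(ler_pM2l s0) -expr2; apply: le_trans h2 _.
  by rewrite mulrCA mulrA ler_wpM2r.
by exists (Bop _ SL SB).
Qed.

Lemma rdot_adj T x y : rdot (T x) y = rdot x (adj T y).
Proof. by rewrite /rdot adjP. Qed.

Lemma adj_unique T S : adjoint_of T S -> adj T = S.
Proof.
move=> TS; apply: bopP => y; apply: hdot_inj => x.
by rewrite hdotC -adjP TS -hdotC.
Qed.

Lemma adj_unique_rdot T S : (forall x y, rdot (T x) y = rdot x (S y)) -> adj T = S.
Proof.
move=> TS; apply: bopP => y; apply: rdot_inj => x.
by rewrite rdotC -rdot_adj TS -rdotC.
Qed.

Lemma adjK : involutive (@adj R H).
Proof. by move=> T; apply: adj_unique_rdot => x y;
  rewrite rdotC -rdot_adj rdotC. Qed.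
Lemma adjD S T : adj (S + T) = adj S + adj T.
Proof. by apply: adj_unique_rdot => x y; rewrite /= !rdotE !rdot_adj. Qed.
Lemma adjN T : adj (- T) = - adj T.
Proof. by apply: adj_unique_rdot => x y; rewrite /= !rdotE !rdot_adj. Qed.
Lemma adjB S T : adj (S - T) = adj S - adj T.
Proof. by rewrite adjD adjN. Qed.
Lemma adjM S T : adj (S * T) = adj T * adj S.
Proof. by apply: adj_unique_rdot => x y; rewrite /= !rdot_adj. Qed.
Lemma adj1 : adj (1 : bop H) = 1.
Proof. by apply: adj_unique_rdot. Qed.
Lemma adj0 : adj (0 : bop H) = 0.
Proof. by apply: adj_unique_rdot => x y; rewrite /= !rdotE. Qed.
Lemma adjZ a T : adj (a *: T) = a^* *: adj T.
Proof.
apply: adj_unique => x y /=; rewrite hdotZl hdotZr conjCK.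
by congr (_ * _); apply: adjP.
Qed.

End Adjoint.

(** The hypotheses give [r ^+ 2 <= C * s ^+ 2], and [C <= (1 + C) ^+ 2]. This turns a Cauchy-Schwarz
    estimate into a linear bound. *)
Lemma le_sqr_prod (F : realFieldType) (C s t r : F) :
  0 <= C -> 0 <= s -> t <= C * s -> r ^+ 2 <= t * s -> r <= (1 + C) * s.
Proof.
move=> C0 s0 tC rs; rewrite leNgt; apply/negP => rbig.
have Cs : 0 <= (1 + C) * s by rewrite mulr_ge0// addr_ge0.
have : ((1 + C) * s) ^+ 2 < r ^+ 2
  by rewrite ltr_pXn2r ?nnegrE// ltW// (le_lt_trans Cs).
have := mulr_ge0 C0 s0; have := sqr_ge0 s; have := ler_wpM2r s0 tC; nra.
Qed.

(** * Pseudospectra and the numerical range *)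

Section Pseudospectrum.
Variables (R : realType) (H : hilbertType R).
Implicit Types (x y z : H) (S T K X Y A B : bop H) (m : R).

(** The numerical range of [X] lies in the half-plane of real part at most [m], in homogeneous
    form. *)
Definition rdot_le X m := forall x, rdot (X x) x <= m * nsq x.

Lemma Re_norm_sqr x : complex.Re `|x| ^+ 2 = nsq x.
Proof.
have := nsq_norm x; have := normr_ge0 x; case: `|x| => a b.
rewrite lecE /= => /andP[/eqP -> _] /eqP; rewrite expr2 eq_complex /=.
by rewrite mulr0 subr0 => /andP[/eqP <- _]; rewrite expr2.
Qed.

Lemma Re_norm_ge0 x : 0 <= complex.Re `|x|.
Proof. by have := normr_ge0 x; rewrite lecE => /andP[]. Qed.

Lemma norm_le1 x : (`|x| <= 1) = (nsq x <= 1).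
Proof. by rewrite -[1 in LHS]/(1%:C) norm_le_nsq// expr1n. Qed.

Lemma opnorm_nsq A (e : R) x : 0 <= e -> opnorm A <= e -> nsq (A x) <= e ^+ 2 * nsq x.
Proof.
move=> e0 Ae; have [->|x0] := eqVneq x 0; first by rewrite bop_0 nsq0 mulr0.
have [K K0 AK] := bounded_nsq (bop_bounded A).
have xp := nsq_gt0 x0; set k : R := (Num.sqrt (nsq x))^-1.
have k2 : k ^+ 2 * nsq x = 1.
  by rewrite exprVn sqr_sqrtr ?ltW// mulVf// gt_eqF.
have : complex.Re `|A (k%:C *: x)| <= e.
  apply: le_trans Ae; apply: sup_ubound; last first.
    by exists (k%:C *: x) => //=; rewrite norm_le1 nsqZr k2.
  (* The set whose supremum is [opnorm A] must be bounded; [1 + K] works because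
     [K <= (1 + K) ^+ 2]. *)
  exists (1 + K) => _ [y /= + <-]; rewrite norm_le1 => y1.
  rewrite -(@ler_pXn2r _ 2) ?nnegrE ?Re_norm_ge0 ?addr_ge0 ?(ltW K0)//.
  rewrite Re_norm_sqr; apply: le_trans (AK y) _.
  have := nsq_ge0 y; nra.
rewrite -(@ler_pXn2r _ 2) ?nnegrE ?Re_norm_ge0// Re_norm_sqr bopZ nsqZr => h.
have k0 : 0 < k ^+ 2 by rewrite exprn_gt0// invr_gt0 sqrtr_gt0.
by rewrite -(ler_pM2l k0) mulrCA k2 mulr1.
Qed.

Lemma opnorm_scalar_le (a : R[i]) (e : R) : `|a| <= e%:C -> opnorm (a *: (1 : bop H)) <= e.
Proof.
move=> ae; apply: ge_sup.
  by exists (complex.Re `|(a *: (1 : bop H)) 0|), 0 => //=; rewrite normr0.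
move=> _ [x /= x1 <-]; rewrite normrZ.
have : `|a| * `|x| <= e%:C * 1 by apply: ler_pM.
by rewrite mulr1 lecE => /andP[].
Qed.

Lemma rdot_opnorm A (e : R) x : 0 <= e -> opnorm A <= e -> rdot (A x) x <= e * nsq x.
Proof.
move=> e0 Ae; have := rdot_cauchy_schwarz (A x) x; have := opnorm_nsq x e0 Ae.
have := nsq_ge0 x; move: (nsq x) (nsq (A x)) (rdot _ _) => s t r s0 h1 h2.
have es := mulr_ge0 e0 s0; rewrite leNgt; apply/negP => rbig.
have : r ^+ 2 <= (e * s) ^+ 2.
  by apply: le_trans h2 _; rewrite exprMn [s ^+ 2]expr2 mulrA ler_wpM2r.
rewrite ler_pXn2r ?nnegrE//; first by rewrite leNgt rbig.
exact: le_trans (ltW rbig).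
Qed.

(** Beyond the line of real part [m + e], the operator [l - X - A] is coercive with constant
    [Re l - (m + e)], hence invertible. *)
Lemma pseudospectrum_Re_le X m (e : R) (l : R[i]) : 0 <= e -> rdot_le X m ->
  pseudospectrum e X l -> complex.Re l <= m + e.
Proof.
move=> e0 Xm [A /= Ae]; apply: contra_notP => /negP; rewrite -ltNge => lbig.
apply: (@coercive_invertible _ _ _ (complex.Re l - (m + e))); first lra.
move=> x; rewrite /= !rdotE; have := Xm x; have := rdot_opnorm x e0 Ae.
have -> : rdot (l *: x) x = complex.Re l * nsq x
  by rewrite /rdot hdotZl nsqE mulrC ReZ mulrC.
lra.
Qed.

(** [M] is the least upper bound of the numerical range, so [P = M - K] is positive. An inverse of
    [P] would bound [P] away from zero and leave the smaller upper bound [M - t / C1]. *)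
Lemma top_spectrum K : adj K = K -> (exists x : H, x != 0) ->
  exists2 M, rdot_le K M & spectrum K M%:C.
Proof.
move=> Ksa [x1 x10].
have [C C0 KC] := bounded_nsq (bop_bounded K).
have nsq1 := nsq_gt0 x10.
pose E := [set m | rdot_le K m].
have infE : has_inf E.
  split.
    exists (1 + C) => x; have := rdot_cauchy_schwarz (K x) x; have := KC x.
    exact: le_sqr_prod (ltW C0) (nsq_ge0 x).
  exists (rdot (K x1) x1 / nsq x1) => m /(_ x1).
  by rewrite ler_pdivrMr.
pose M := inf E; have KM : rdot_le K M.
  move=> x; have [->|x0] := eqVneq x 0; first by rewrite nsq0 rdot0r mulr0.
  rewrite -ler_pdivrMr ?nsq_gt0//; apply: lb_le_inf; first exact: infE.1.
  by move=> m /(_ x); rewrite ler_pdivrMr ?nsq_gt0.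
exists M => // -[S [_ SP]].
set P : bop H := _ - K in SP.
have Psa x y : rdot (P x) y = rdot x (P y) by rewrite /= !rdotE rdot_adj Ksa.
have PE x : rdot (P x) x = M * nsq x - rdot (K x) x by rewrite /= !rdotE.
have P0 x : 0 <= rdot (P x) x by rewrite PE subr_ge0.
clearbody P.
have [C1 C10 SC1] := bounded_nsq (bop_bounded S).
have [C2 C20 PC2] := bounded_nsq (bop_bounded P).
pose t := (1 + C2)^-1; have t0 : 0 < t by rewrite invr_gt0; lra.
have tN : t * (1 + C2) = 1 by rewrite mulVf// gt_eqF//; lra.
(* Positivity of [P] is tested at [x - t P x]; the choice of [t] makes the quadratic term at most
   [t * nsq (P x)]. *)
have PP x : t * nsq (P x) <= rdot (P x) x.
  have := P0 (x - t%:C *: P x).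
  rewrite bopD bopN bopZ !rdotE (Psa (P x) x) -/(nsq (P x)).
  have := rdot_cauchy_schwarz (P (P x)) (P x); have := PC2 (P x).
  have := nsq_ge0 (P x).
  move: (nsq (P x)) (nsq (P (P x))) (rdot (P (P x)) (P x)) (rdot (P x) x) => s q r p s0 h1 h2 h3.
  have := le_sqr_prod (ltW C20) s0 h1 h2 => /(ler_wpM2l (ltW t0));
    rewrite mulrA tN mul1r => /(ler_wpM2l (ltW t0)).
  lra.
have : M <= M - t / C1.
  apply: ge_inf; first exact: infE.2.
  move=> x; have := PP x; have := SC1 (P x).
  have -> : S (P x) = x by have /(congr1 (fun T : bop H => T x)) := SP.
  rewrite PE => h1 h2.
  have : t / C1 * nsq x <= t * nsq (P x).
    rewrite -mulrA ler_wpM2l ?(ltW t0)// ler_pdivrMl//.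
  by rewrite /=; lra.
have : 0 < t / C1 by rewrite divr_gt0.
lra.
Qed.

(** The perturbation by [e] times the identity puts [M + e] into the pseudospectrum, with [M] the
    top of the numerical range. The zero space, where the spectrum is empty, is treated apart. *)
Lemma rdot_le_pseudospectrum K m (e : R) : adj K = K -> 0 <= e ->
  (forall l, pseudospectrum e K l -> complex.Re l <= m + e) -> rdot_le K m.
Proof.
move=> Ksa e0 Ke; have [[x1 x10]|triv] := pselect (exists x : H, x != 0);
  last first.
  move=> x; have -> : x = 0 by apply/eqP/negPn/negP => x0; apply: triv;
    exists x.
  by rewrite nsq0 rdot0r mulr0.
have [M KM MK] := top_spectrum Ksa (ex_intro _ x1 x10).
suff Mm : M <= m by move=> x; apply: le_trans (KM x) _;
  rewrite ler_wpM2r ?nsq_ge0.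
have : complex.Re (M + e)%:C <= m + e.
  apply: Ke; exists (e%:C *: (1 : bop H)).
    by apply: opnorm_scalar_le; rewrite ger0_norm// ler0c.
  by rewrite /spectrum /= rmorphD /= scalerDl opprD addrACA subrr addr0.
by rewrite /= lerD2r.
Qed.

Lemma invertibleZ (u : R[i]) T : u != 0 -> invertible T -> invertible (u *: T).
Proof.
move=> u0 [S [TS ST]]; exists (u^-1 *: S).
split; apply: bopP => x /=; rewrite bopZ scalerA ?mulVf ?mulfV// scale1r.
  exact: (congr1 (fun A : bop H => A x) TS).
exact: (congr1 (fun A : bop H => A x) ST).
Qed.

(** The perturbation [A] is replaced by [u *: A]; [u] is unimodular so that its norm stays the
    same. *)
Lemma pseudospectrumZ (u : R[i]) (e : R) X l : `|u| = 1 ->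
  pseudospectrum e X l -> pseudospectrum e (u *: X) (u * l).
Proof.
move=> u1 [A /= Ae XA].
have u0 : u != 0 by rewrite -normr_eq0 u1 oner_eq0.
exists (u *: A).
  rewrite /= (_ : opnorm (u *: A) = opnorm A)//; congr sup.
  by apply: eq_imagel => x _ /=; rewrite normrZ u1 mul1r.
have u0' : u^-1 != 0 by rewrite invr_eq0.
move=> /(invertibleZ u0') h; apply: XA.
by move: h; rewrite -scalerDr -scalerA -scalerBr scalerA mulVf// scale1r.
Qed.

Lemma pseudospectrum_eqZ (u : R[i]) (e : R) X Y : `|u| = 1 ->
  pseudospectrum e X = pseudospectrum e Y ->
  pseudospectrum e (u *: X) = pseudospectrum e (u *: Y).
Proof.
move=> u1; have u0 : u != 0 by rewrite -normr_eq0 u1 oner_eq0.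
have u1' : `|u^-1| = 1 by rewrite normfV u1 invr1.
suff sub A B : pseudospectrum e A = pseudospectrum e B ->
    pseudospectrum e (u *: A) `<=` pseudospectrum e (u *: B).
  by move=> h; apply/seteqP; split; apply: sub.
move=> AB l /(pseudospectrumZ u1'); rewrite scalerA mulVf// scale1r AB.
by move=> /(pseudospectrumZ u1); rewrite mulrA mulfV// mul1r.
Qed.

Lemma rdot_le_pseudospectrum_eq (e m : R) K1 K2 : adj K1 = K1 -> adj K2 = K2 ->
  0 <= e -> pseudospectrum e K1 = pseudospectrum e K2 ->
  rdot_le K1 m <-> rdot_le K2 m.
Proof.
suff imp K K' : adj K' = K' -> 0 <= e ->
    pseudospectrum e K = pseudospectrum e K' -> rdot_le K m -> rdot_le K' m.
  by move=> sa1 sa2 e0 h; split; apply: imp.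
move=> sa e0 h Km; apply: (rdot_le_pseudospectrum sa e0) => l.
by rewrite -h; apply: pseudospectrum_Re_le.
Qed.

End Pseudospectrum.

(** * Self-adjoint and rank one operators *)

Section SelfAdjoint.
Variables (R : realType) (H : hilbertType R).
Implicit Types (x y z : H) (S T X Y : bop H) (m : R).

(** Polarization: for a form vanishing on the diagonal, the relation at [x], [y] is combined with
    the one at [x], ['i *: y], in which one term changes sign. *)
Lemma bop_inj X Y : (forall x, hdot (X x) x = hdot (Y x) x) -> X = Y.
Proof.
suff zero (Z : bop H) : (forall x, hdot (Z x) x = 0) -> forall x, Z x = 0.
  move=> XY; apply: bopP => x; apply/eqP; rewrite -subr_eq0; apply/eqP.
  by apply: (zero (X - Y)) => y /=; rewrite hdotDl hdotNl XY subrr.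
move=> Z0 x; apply: rdot_inj => y; rewrite rdot0l.
have Zr u : rdot (Z u) u = 0 by rewrite /rdot Z0.
have Zi u : rdot (Z u) ('i *: u) = 0 by have := Z0 u; rewrite hdot_rdot => -[].
have sym u v : rdot (Z u) v + rdot (Z v) u = 0.
  by have := Zr (u + v); rewrite bopD !rdotE !Zr; lra.
have symi u v : rdot (Z u) ('i *: v) + rdot (Z v) ('i *: u) = 0.
  by have := Zi (u + v); rewrite bopD scalerDr !rdotE !Zi; lra.
have := symi x y; have := symi x ('i *: y); have := sym x y.
rewrite bopZ rdot_i scalerA -expr2 sqrCi scaleN1r rdotNr; lra.
Qed.

Lemma selfadj_inj X Y : adj X = X -> adj Y = Y ->
  (forall x, rdot (X x) x = rdot (Y x) x) -> X = Y.
Proof.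
move=> Xa Ya XY; apply: bop_inj => x; rewrite !hdot_rdot XY; congr Complex.
have im0 (Z : bop H) : adj Z = Z -> rdot (Z x) ('i *: x) = 0.
  by move=> Za; have := rdot_iC (Z x) x;
    rewrite -bopZ rdot_adj Za (rdotC _ (Z x)); lra.
by rewrite !im0.
Qed.

Lemma adj_scale_real (k : R) X : adj X = X -> adj (k%:C *: X) = k%:C *: X.
Proof. by move=> Xa; rewrite adjZ Xa conj_real. Qed.

(** The rotation by [|a| / a] makes the factor a positive real [k], which only rescales the
    numerical range. *)
Lemma selfadj_pseudospectrum_le (e : R) (a : R[i]) X Y : 0 <= e -> a != 0 ->
  adj X = X -> adj Y = Y ->
  pseudospectrum e (a *: X) = pseudospectrum e (a *: Y) ->
  forall m, rdot_le X m <-> rdot_le Y m.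
Proof.
move=> e0 a0 Xa Ya aXY.
have u1 : `| `|a| / a | = 1 by rewrite normf_div normr_id mulfV// normr_eq0.
have := pseudospectrum_eqZ u1 aXY; rewrite !scalerA divfK//.
have : 0 < `|a| by rewrite normr_gt0.
case: `|a| => k ki; rewrite ltcE /= => /andP[/eqP -> k0]; rewrite -/(k%:C).
move=> kXY m.
have scale (Z : bop H) : rdot_le (k%:C *: Z) (k * m) <-> rdot_le Z m.
  by split => h x; have := h x; rewrite /= !rdotE -mulrA ler_pM2l.
by rewrite -scale -(scale Y); apply: rdot_le_pseudospectrum_eq kXY => //;
  apply: adj_scale_real.
Qed.

Lemma selfadj_pseudospectrum_ge (e : R) (a : R[i]) X Y : 0 <= e -> a != 0 ->
  adj X = X -> adj Y = Y ->
  pseudospectrum e (a *: X) = pseudospectrum e (a *: Y) ->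
  forall m, rdot_le (- X) m <-> rdot_le (- Y) m.
Proof.
move=> e0 a0 Xa Ya aXY; apply: (@selfadj_pseudospectrum_le e (- a)) => //.
- by rewrite oppr_eq0.
- by rewrite adjN Xa.
- by rewrite adjN Ya.
- by rewrite !scaleNr !scalerN !opprK.
Qed.

(** Both endpoints of the numerical range of [X] are [k]. *)
Lemma selfadj_pseudospectrum_scalar (e : R) (a : R[i]) X (k : R) :
  0 <= e -> a != 0 -> adj X = X ->
  pseudospectrum e (a *: X) = pseudospectrum e (a *: (k%:C *: (1 : bop H))) ->
  X = k%:C *: (1 : bop H).
Proof.
move=> e0 a0 Xa aX.
have ka : adj (k%:C *: (1 : bop H)) = k%:C *: (1 : bop H)
  by apply: adj_scale_real; exact: adj1.
apply: selfadj_inj => // x; apply/eqP; rewrite eq_le.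
have := (selfadj_pseudospectrum_le e0 a0 Xa ka aX k).2.
have := (selfadj_pseudospectrum_ge e0 a0 Xa ka aX (- k)).2.
move=> h1 h2.
have := h1 _ x; have := h2 _ x;
  rewrite /= !rdotE -/(nsq x) mulNr lerN2 => -> //.
  by move=> -> // y; rewrite /= !rdotE mulNr.
by move=> y; rewrite /= !rdotE.
Qed.

Lemma selfadj_pseudospectrum0 (e : R) (a : R[i]) X : 0 <= e -> a != 0 ->
  adj X = X -> pseudospectrum e (a *: X) = pseudospectrum e (0 : bop H) -> X = 0.
Proof.
move=> e0 a0 Xa aX; have := selfadj_pseudospectrum_scalar (k := 0) e0 a0 Xa.
by rewrite (_ : 0%:C = 0)// !scale0r scaler0; apply.
Qed.

End SelfAdjoint.

(** * Rank one operators and their symmetric sums *)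

Section RankOne.
Variables (R : realType) (H : hilbertType R).
Implicit Types (v w x y z : H) (S T : bop H).

Fact rank1_linear x y : linear (fun z => hdot z y *: x).
Proof. by move=> a u v; rewrite hdotDl hdotZl scalerDl scalerA. Qed.
Fact rank1_bounded x y : bounded_map (fun z => hdot z y *: x).
Proof.
apply: (@nsq_bounded _ _ _ (nsq x * nsq y)) => [|z].
  by rewrite mulr_ge0 ?nsq_ge0.
rewrite nsqZ -add_Re2_Im2 hdot_rdot /= mulrC -mulrA ler_wpM2l ?nsq_ge0//.
by rewrite (mulrC (nsq y)); apply: hdot_cauchy_schwarz.
Qed.
Definition rank1 x y : bop H := Bop _ (rank1_linear x y) (rank1_bounded x y).

Lemma adj_rank1 x y : adj (rank1 x y) = rank1 y x.
Proof. by apply: adj_unique => u v /=; rewrite hdotZl hdotZr -hdotC mulrC. Qed.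

Lemma mul_rank1l S x y : S * rank1 x y = rank1 (S x) y.
Proof. by apply: bopP => z /=; rewrite bopZ. Qed.

Lemma mul_rank1r S x y : rank1 x y * S = rank1 x (adj S y).
Proof. by apply: bopP => z /=; rewrite adjP. Qed.

Lemma rank1Dl x y z : rank1 (x + y) z = rank1 x z + rank1 y z.
Proof. by apply: bopP => u /=; rewrite scalerDr. Qed.

Lemma rank1Zl a x y : rank1 (a *: x) y = a *: rank1 x y.
Proof. by apply: bopP => u /=; rewrite !scalerA mulrC. Qed.

Lemma rank1Nl x y : rank1 (- x) y = - rank1 x y.
Proof. by apply: bopP => u /=; rewrite scalerN. Qed.

Lemma rank1Nr x y : rank1 x (- y) = - rank1 x y.
Proof. by apply: bopP => u /=; rewrite hdotNr scaleNr. Qed.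

Definition sym_rank2 w y := rank1 w y + rank1 y w.

Lemma adj_sym_rank2 w y : adj (sym_rank2 w y) = sym_rank2 w y.
Proof. by rewrite adjD !adj_rank1 addrC. Qed.

Lemma sym_rank2N w y : sym_rank2 (- w) y = - sym_rank2 w y.
Proof. by rewrite /sym_rank2 rank1Nl rank1Nr opprD. Qed.

Lemma rdot_sym_rank2 w y v :
  rdot (sym_rank2 w y v) v = 2 * rdot (hdot v y *: w) v.
Proof.
rewrite /sym_rank2 /= rdotDl;
  have -> : rdot (hdot v w *: y) v = rdot (hdot v y *: w) v.
  by rewrite /rdot !hdotZl -[RHS]ReJ rmorphM /= -!hdotC mulrC.
by ring.
Qed.

Lemma hdot_proj_orth v y : nsq y = 1 -> hdot (v - hdot v y *: y) y = 0.
Proof. by move=> y1; rewrite hdotDl hdotNl hdotZl nsqE y1 mulr1 subrr. Qed.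

Lemma nsq_proj_orth v y : nsq y = 1 ->
  nsq (v - hdot v y *: y) = nsq v - rdot v y ^+ 2 - rdot v ('i *: y) ^+ 2.
Proof.
move=> y1; have orth : rdot (v - hdot v y *: y) (hdot v y *: y) = 0.
  by rewrite /rdot hdotZr hdot_proj_orth// mulr0.
have : nsq v = nsq (v - hdot v y *: y + hdot v y *: y) by rewrite subrK.
rewrite nsqD orth nsqZ y1 => ->.
by rewrite -add_Re2_Im2 hdot_rdot /=; ring.
Qed.

(** In other terms [|p| <= s]: of the eigenvalues [p + s] and [p - s] used below, the first is
    nonnegative and the second nonpositive. *)
Lemma sqrt_sum_bound (F : rcfType) (p b : F) : 0 <= b ->
  let s := Num.sqrt (p ^+ 2 + b) in
  [/\ s ^+ 2 = p ^+ 2 + b, 0 <= s - p & 0 <= s + p].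
Proof.
move=> b0; have pb : 0 <= p ^+ 2 + b by rewrite addr_ge0 ?sqr_ge0.
split; first by rewrite sqr_sqrtr.
  by rewrite subr_ge0; apply: le_trans (ler_norm p) _;
    rewrite -sqrtr_sqr ler_sqrt// lerDl.
rewrite -(opprK p) subr_ge0; apply: le_trans (ler_norm _) _.
by rewrite normrN opprK -sqrtr_sqr ler_sqrt// lerDl.
Qed.

(* With [z] the component of [w] orthogonal to [y], the operator vanishes off
   the span of [y] and [z], and has there the eigenvalues
   [p + s] and [p - s], where [p = rdot w y] and [s ^+ 2 = p ^+ 2 + nsq z]. *)
Lemma rdot_le_sym_rank2 w y (m : R) : nsq y = 1 ->
  (exists2 u : H, u != 0 & hdot u y = 0) ->
  rdot_le (sym_rank2 w y) m <->
  rdot w y + Num.sqrt (nsq w - rdot w ('i *: y) ^+ 2) <= m.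
Proof.
move=> y1 [u u0 uy].
set b := hdot w y; set z := w - b *: y; set p := rdot w y.
have zy : hdot z y = 0 by exact: hdot_proj_orth.
have nz : nsq w - rdot w ('i *: y) ^+ 2 = p ^+ 2 + nsq z.
  by rewrite nsq_proj_orth// /p; ring.
have [] := sqrt_sum_bound p (nsq_ge0 z); rewrite nz.
set s := Num.sqrt _ => s2 sp1 sp2.
have wE : w = z + b *: y by rewrite subrK.
clearbody z.
have bRe : complex.Re b = p by [].
split=> [wm|tm v].
  have zwE : rdot w z = nsq z.
    rewrite {1}wE rdotDl -/(nsq z) [X in _ + X](_ : _ = 0) ?addr0//.
    by rewrite /rdot hdotZl hdotC zy conjC0 mulr0.
  (* In general [(p + s) y + z] is an eigenvector for [p + s]. If it vanishes, then [p + s = 0], and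
     the vector [u] orthogonal to [y] is tested instead. *)
  have [e|e] := eqVneq ((p + s) ^+ 2 + nsq z) 0.
    have t0 : p + s = 0.
      by apply/eqP; rewrite -sqrf_eq0; apply/eqP; have := sqr_ge0 (p + s);
        have := nsq_ge0 z; lra.
    rewrite t0; have := wm u; rewrite rdot_sym_rank2 uy scale0r rdot0l mulr0.
    by rewrite pmulr_lge0// nsq_gt0.
  have vy : hdot ((p + s)%:C *: y + z) y = (p + s)%:C.
    by rewrite hdotDl hdotZl zy nsqE y1 addr0 mulr1.
  have := wm ((p + s)%:C *: y + z); rewrite rdot_sym_rank2 vy.
  rewrite rdotZl rdotDr rdotZr zwE -/p nsqD nsqZr y1.
  have -> : rdot ((p + s)%:C *: y) z = 0 by rewrite rdotZl rdotC /rdot zy mulr0.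
  have ep : 0 < (p + s) ^+ 2 + nsq z
    by rewrite lt_neqAle eq_sym e addr_ge0 ?sqr_ge0 ?nsq_ge0.
  move=> h; rewrite -(ler_pM2r ep);
    have : (p + s) ^+ 2 = 2 * p * (p + s) + nsq z.
    by rewrite sqrrD s2; ring.
  by move=> /(congr1 ( *%R (p + s))); move: h; lra.
rewrite rdot_sym_rank2; set a := hdot v y; set v' := v - a *: y.
have v'y : hdot v' y = 0 by exact: hdot_proj_orth.
pose A := complex.Re (`|a| ^+ 2).
have aE : A = rdot v y ^+ 2 + rdot v ('i *: y) ^+ 2.
  by rewrite /A -add_Re2_Im2 /a hdot_rdot.
have A0 : 0 <= A by rewrite aE addr_ge0 ?sqr_ge0.
have nv : nsq v = A + nsq v' by rewrite nsq_proj_orth// aE; ring.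
have vE : v = v' + a *: y by rewrite subrK.
clearbody v' a.
have -> : rdot (a *: w) v = A * p + rdot (a *: z) v'.
  rewrite {1}wE {1}vE scalerDr scalerA !rdotDl !rdotDr.
  have -> : rdot (a *: z) (a *: y) = 0 by rewrite /rdot hdotZl hdotZr zy !mulr0.
  have -> : rdot (a * b *: y) v' = 0.
    by rewrite /rdot hdotZl hdotC v'y conjC0 mulr0.
  have -> : rdot (a * b *: y) (a *: y) = A * p.
    rewrite /rdot hdotZl hdotZr nsqE y1 mulr1 mulrAC -normCK.
    by rewrite -add_Re2_Im2 ReZ /A -add_Re2_Im2 bRe.
  by ring.
rewrite nv; apply: (@le_trans _ _ ((p + s) * (A + nsq v'))); last first.
  by rewrite ler_wpM2r// addr_ge0 ?nsq_ge0.
have := rdot_cauchy_schwarz (a *: z) v'; rewrite nsqZ -/A.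
have n0 := nsq_ge0 v';
  have zE : nsq z = (s - p) * (s + p) by rewrite -subr_sqr s2; ring.
have U0 := mulr_ge0 sp1 A0; have W0 := mulr_ge0 sp2 n0.
rewrite zE; move: (rdot _ v') (nsq v') n0 W0 => q n n0 W0 h.
(* Cauchy-Schwarz bounds [q ^+ 2] by the product of the two summands on the right, so the inequality
   of means applies. *)
suff : 2 * q <= (s - p) * A + (s + p) * n by lra.
have := h;
  have -> : A * ((s - p) * (s + p)) * n = (s - p) * A * ((s + p) * n) by ring.
move: ((s - p) * A) ((s + p) * n) U0 W0 => U W U0 W0 qUW.
rewrite leNgt; apply/negP => qbig; have := sqr_ge0 (U - W); nra.
Qed.

(** The tops of the numerical ranges of the operator and of its negative are [p + s] and [- p + s];
    together they determine [p = rdot w y] and the root [s]. *)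
Lemma sym_rank2_pseudospectrum (e : R) (a : R[i]) w y w' y' :
  0 <= e -> a != 0 -> nsq y = 1 -> nsq y' = 1 ->
  (exists2 u : H, u != 0 & hdot u y = 0) ->
  (exists2 u : H, u != 0 & hdot u y' = 0) ->
  pseudospectrum e (a *: sym_rank2 w y) = pseudospectrum e (a *: sym_rank2 w' y') ->
  rdot w y = rdot w' y' /\
  nsq w - rdot w ('i *: y) ^+ 2 = nsq w' - rdot w' ('i *: y') ^+ 2.
Proof.
move=> e0 a0 y1 y1' uy uy' h.
have := selfadj_pseudospectrum_ge e0 a0 (adj_sym_rank2 w y) (adj_sym_rank2 w' y') h.
have {h} := selfadj_pseudospectrum_le e0 a0 (adj_sym_rank2 w y) (adj_sym_rank2 w' y') h.
have eq_bound (p q : R) : (forall m, p <= m <-> q <= m) -> p = q.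
  by move=> pq; apply/eqP; rewrite eq_le (pq q).2// (pq p).1.
move=> le1 le2.
have h1 : rdot w y + Num.sqrt (nsq w - rdot w ('i *: y) ^+ 2) =
    rdot w' y' + Num.sqrt (nsq w' - rdot w' ('i *: y') ^+ 2).
  by apply: eq_bound => m; rewrite -!rdot_le_sym_rank2.
have h2 : - rdot w y + Num.sqrt (nsq w - rdot w ('i *: y) ^+ 2) =
    - rdot w' y' + Num.sqrt (nsq w' - rdot w' ('i *: y') ^+ 2).
  apply: eq_bound => m; have := le2 m.
  rewrite -!sym_rank2N !rdot_le_sym_rank2//.
  by rewrite !rdotNl !nsqN !sqrrN.
split; first lra.
have D0 v z : nsq z = 1 -> 0 <= nsq v - rdot v ('i *: z) ^+ 2.
  move=> z1; have := hdot_cauchy_schwarz v z; rewrite z1 mulr1.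
  by have := sqr_ge0 (rdot v z); lra.
rewrite -[LHS]sqr_sqrtr ?D0// -[RHS]sqr_sqrtr ?D0//; congr (_ ^+ 2); lra.
Qed.

End RankOne.

(** Otherwise every vector would equal its projection onto the line of [y], and [y] alone would span
    the space. *)
Lemma exists_orthogonal (R : realType) (H : hilbertType R) :
  infinite_dimensional H -> forall y : H, exists2 u : H, u != 0 & hdot u y = 0.
Proof.
move=> infH y; apply: contrapT => no.
have noP u : hdot u y = 0 -> u = 0.
  by move=> uy; apply/eqP/negPn/negP => u0; apply: no; exists u.
apply: (infH [set y] (finite_set1 y)); apply/seteqP; split=> // v _.
exists 1%N, (fun=> hdot v y / hdot y y), (fun=> y); split=> //.
rewrite big_ord1; apply/eqP; rewrite -subr_eq0; apply/eqP/noP.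
rewrite hdotDl hdotNl hdotZl; have [->|y0] := eqVneq y 0.
  by rewrite !hdot0r mulr0 subrr.
rewrite divfK ?subrr// nsqE; apply: contraNneq y0 => /complexI/nsq_eq0 ->.
by [].
Qed.

(** * Unit vectors, scalar operators and idempotents *)

Section BopAlgebra.
Variables (R : realType) (H : hilbertType R).
Implicit Types (x y z : H) (S T X Y P : bop H).

Lemma bop_scaleAl a S T : (a *: S) * T = a *: (S * T).
Proof. exact: bopP. Qed.

Lemma bop_scaleAr a S T : S * (a *: T) = a *: (S * T).
Proof. by apply: bopP => x /=; rewrite bopZ. Qed.

Lemma normalize x : x != 0 -> exists2 k : R, 0 < k & nsq (k%:C *: x) = 1.
Proof.
move=> x0; have xp := nsq_gt0 x0; exists (Num.sqrt (nsq x))^-1.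
  by rewrite invr_gt0 sqrtr_gt0.
by rewrite nsqZr exprVn sqr_sqrtr ?ltW// mulVf// gt_eqF.
Qed.

Lemma bop_inj_unit X Y :
  (forall x, nsq x = 1 -> hdot (X x) x = hdot (Y x) x) -> X = Y.
Proof.
move=> XY; apply: bop_inj => x; have [->|x0] := eqVneq x 0;
  first by rewrite !hdot0r.
have [k k0 kx] := normalize x0.
have := XY _ kx; rewrite !bopZ !hdotZl !hdotZr.
have kC : k%:C != 0 :> R[i] by rewrite (inj_eq (@complexI _)) gt_eqF.
by move=> /(mulfI kC)/mulfI; apply; rewrite conj_real.
Qed.

Lemma selfadj_hdot X x : adj X = X -> hdot (X x) x = (rdot (X x) x)%:C.
Proof.
move=> Xa; rewrite hdot_rdot; congr Complex.
by have := rdot_iC (X x) x; rewrite -bopZ rdot_adj Xa (rdotC _ (X x)); lra.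
Qed.

Lemma selfadj_rdot_i X x : adj X = X -> rdot (X x) ('i *: x) = 0.
Proof. by move=> Xa; have := selfadj_hdot x Xa;
  rewrite {1}hdot_rdot => -[]. Qed.

Lemma selfadj_inj_unit X Y : adj X = X -> adj Y = Y ->
  (forall x, nsq x = 1 -> rdot (X x) x = rdot (Y x) x) -> X = Y.
Proof.
by move=> Xa Ya XY; apply: bop_inj_unit => x /XY h; rewrite !selfadj_hdot// h.
Qed.

Lemma selfadj_rdot_i_eq0 X : (forall x, nsq x = 1 -> rdot (X x) ('i *: x) = 0) ->
  adj X = X.
Proof.
move=> Xi; apply: bop_inj_unit => x /Xi h.
have hX : hdot (X x) x = (rdot (X x) x)%:C by rewrite hdot_rdot h.
by rewrite hdotC -adjP hX conj_real.
Qed.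

(** Self-adjointness forces the eigenvalue at [u] to agree with the one at a fixed [y] whenever
    [hdot u y != 0]. A vector [z] orthogonal to [y] is reached through [z + y]. *)
Lemma selfadj_eigen_scalar X : (exists x : H, x != 0) -> adj X = X ->
  (forall x, nsq x = 1 -> X x = (rdot (X x) x)%:C *: x) ->
  exists c : R, X = c%:C *: (1 : bop H).
Proof.
move=> [x0 x00] Xa Xe; have [k k0 kx] := normalize x00.
set y := k%:C *: x0 in kx; have := Xe _ kx.
move: (rdot (X y) y) => c Xy; exists c; apply: bopP => z /=.
have eig u : hdot u y != 0 -> X u = c%:C *: u.
  move=> uy; have u0 : u != 0 by apply: contraNneq uy => ->; rewrite hdot0l.
  have [h h0 hu] := normalize u0.
  have hC : h%:C != 0 :> R[i] by rewrite (inj_eq (@complexI _)) gt_eqF.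
  have := Xe _ hu; set r := rdot _ _; rewrite bopZ !scalerA mulrC -scalerA.
  move=> /(congr1 ( *:%R h%:C^-1)); rewrite !scalerA mulVf// !scale1r => Xu.
  rewrite Xu; congr (_ *: u); apply: (mulIf uy).
  by rewrite -hdotZl -Xu adjP Xa Xy hdotZr conj_real.
have [zy|] := eqVneq (hdot z y) 0; last exact: eig.
have : hdot (z + y) y != 0 by rewrite hdotDl zy add0r nsqE kx oner_eq0.
move=> /eig; rewrite bopD scalerDr Xy => /addIr ->.
by [].
Qed.

(** Multiplying the relation by [P] on the left and on the right shows that [P * X] and [X * P] both
    equal [- (P * X * P)]; hence they coincide and [2 X P = 0]. *)
Lemma anticommute_idem X P : P * P = P -> X * P + P * X = 0 -> X * P = 0 /\ P * X = 0.
Proof.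
move=> PP XP; have XPE : X * P = - (P * X) by apply/eqP; rewrite -addr_eq0 XP.
have PXE : P * X = X * P.
  have h1 : P * X * P + P * X = 0.
    by have := congr1 (fun T : bop H => P * T) XP;
      rewrite mulrDr mulr0 !mulrA PP.
  have h2 : X * P + P * X * P = 0.
    by have := congr1 (fun T : bop H => T * P) XP;
      rewrite mulrDl mul0r -(mulrA X) PP.
  by apply: (addrI (P * X * P)); rewrite h1 addrC h2.
have : X * P = 0.
  apply: bopP => x; have := XP;
    rewrite PXE => /(congr1 (fun T : bop H => T x)) /= h.
  have : (2 : R[i]) *: X (P x) = 0 by rewrite scaler_nat mulr2n.
  by move=> /eqP; rewrite scaler_eq0 pnatr_eq0 /= => /eqP.
by rewrite PXE.
Qed.

Lemma rank1_idem x : nsq x = 1 -> rank1 x x * rank1 x x = rank1 x x.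
Proof. by move=> x1; rewrite mul_rank1l /= nsqE x1 scale1r. Qed.

Lemma rank1_self x : nsq x = 1 -> rank1 x x x = x.
Proof. by move=> x1; rewrite /= nsqE x1 scale1r. Qed.

Lemma selfadj_mul_rank1r X x : adj X = X -> rank1 x x * X = rank1 x (X x).
Proof. by move=> Xa; rewrite mul_rank1r Xa. Qed.

Lemma selfadj_rank1_comm X x : adj X = X ->
  X * rank1 x x + rank1 x x * X = sym_rank2 (X x) x.
Proof. by move=> Xa; rewrite mul_rank1l selfadj_mul_rank1r. Qed.

(** Writes a skew-adjoint operator as ['i] times a symmetric rank two one, so that
    [sym_rank2_pseudospectrum] applies. *)
Lemma circ_star_rank1 X x :
  circ_star (rank1 x x) X = 'i *: sym_rank2 ('i *: X x) x.
Proof.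
rewrite /circ_star mul_rank1l mul_rank1r adjK /sym_rank2; apply: bopP => y /=.
rewrite hdotZr conjCi !scalerDr !scalerA.
have -> (a : R[i]) : 'i * a * 'i = - a by rewrite mulrAC mulCii mulN1r.
have -> (a : R[i]) : 'i * (- 'i * a) = a
  by rewrite mulrA mulrN mulCii opprK mul1r.
by rewrite scaleNr addrC.
Qed.

(** Used when [S - T] is skew-adjoint: the operator in parentheses is then self-adjoint. *)
Lemma sub_swap_i S T : S - T = (- 'i) *: ('i *: (S - T)).
Proof. by rewrite scalerA mulNr mulCii opprK scale1r. Qed.

End BopAlgebra.

(** * Triple product preservers *)

Definition preserves_triple (R : realType) (H : hilbertType R) (eps : R)
    (phi : bop H -> bop H) :=
  forall T1 T2 T3 : bop H,
    pseudospectrum eps (circ_star (diamond T1 T2) T3) =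
    pseudospectrum eps (circ_star (diamond (phi T1) (phi T2)) (phi T3)).

(** * The images of the identity and of i times the identity *)

Section Normalization.
Variables (R : realType) (H : hilbertType R) (eps : R) (phi psi : bop H -> bop H).
Hypotheses (eps0 : 0 <= eps) (nontrivial : exists x : H, x != 0).
Hypothesis psiK : cancel psi phi.
Hypothesis phiP : preserves_triple eps phi.
Hypothesis phi_i : adj (phi ('i *: (1 : bop H))) = - phi ('i *: (1 : bop H)).
Implicit Types (x y z : H) (S T X Y P : bop H).

Local Notation I := (1 : bop H).

Let N2 : (2 : R[i]) != 0. Proof. by rewrite pnatr_eq0. Qed.
Let Ni : ('i : R[i]) != 0. Proof. exact: neq0Ci. Qed.

Lemma diamondT1 T : diamond T 1 = 2 *: T.
Proof. by rewrite /diamond adj1 mulr1 mul1r scaler_nat mulr2n. Qed.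

Lemma diamond_scalar (a : R[i]) (c : R) S :
  diamond (a *: S) (c%:C *: I) = (2 * c%:C * a) *: S.
Proof.
rewrite /diamond adjZ adj1 conj_real !(bop_scaleAl, bop_scaleAr) mulr1 mul1r.
by rewrite !scalerA -scalerDl; congr (_ *: _); ring.
Qed.

Lemma circ_star_i (b : R[i]) S T : adj T = T ->
  circ_star (b *: S) ('i *: T) = (- 'i * b) *: (S * T + T * S).
Proof.
move=> Ta;
  rewrite /circ_star adjZ Ta conjCi !(bop_scaleAl, bop_scaleAr) !scalerA.
by rewrite mulrN mulNr (mulrC b) scalerDr !scaleNr.
Qed.

(** With third argument 1 the left side of the preserver equation is zero, so
    [T * adj (phi 1) - phi 1 * T] has the pseudospectrum of zero up to the factor 2. [T = 1] makes
    [phi 1] self-adjoint; rank one projections then make every unit vector an eigenvector. *)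
Lemma phi1_scalar : exists c : R, phi 1 = c%:C *: I.
Proof.
have key T : pseudospectrum eps (2 *: (T * adj (phi 1) - phi 1 * T)) =
    pseudospectrum eps (0 : bop H).
  have := phiP (psi T) (psi 1) 1; rewrite !psiK diamondT1.
  rewrite /circ_star adj1 mulr1 mul1r subrr => ->.
  by rewrite bop_scaleAl bop_scaleAr -scalerBr.
have zero S : adj S = S -> adj (phi 1) = phi 1 \/ S = 1 ->
    S * adj (phi 1) = phi 1 * S.
  move=> Sa h; apply/eqP; rewrite -subr_eq0; apply/eqP.
  have := key S; rewrite sub_swap_i scalerA => /selfadj_pseudospectrum0 -> //.
  - by rewrite scaler0.
  - by rewrite mulf_neq0// oppr_eq0.
  rewrite adjZ adjB !adjM adjK Sa conjCi scaleNr -scalerN opprB.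
  by case: h => [->|->]; rewrite ?mulr1 ?mul1r.
have Ra : adj (phi 1) = phi 1.
  by have := zero 1 (adj1 _) (or_intror erefl); rewrite mul1r mulr1.
apply: (selfadj_eigen_scalar nontrivial Ra) => y y1.
have := zero (rank1 y y) (adj_rank1 _ _) (or_introl Ra);
  rewrite mul_rank1r mul_rank1l adjK.
move=> /(congr1 (fun T : bop H => T y)) /=; rewrite nsqE y1 scale1r => h.
by rewrite -[LHS]h hdotC selfadj_hdot// conj_real.
Qed.

(** With [phi 1 = c] and [phi ('i *: I) = 'i *: Q], the triples (1, 1, i) and (i, 1, i) give
    [c ^+ 2 Q = 1] and [c Q ^+ 2 = 1]. Squaring the first yields [c ^+ 3 = 1], so the real number
    [c] is 1. *)
Lemma phi1_phii : phi 1 = 1 /\ phi ('i *: I) = 'i *: I.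
Proof.
have [c phi1] := phi1_scalar.
have [Q phiQ Qa] : exists2 Q : bop H, phi ('i *: I) = 'i *: Q & adj Q = Q.
  exists (- 'i *: phi ('i *: I)).
    by rewrite scalerA mulrN mulCii opprK scale1r.
  by rewrite adjZ rmorphN /= conjCi opprK phi_i scalerN scaleNr.
have NiN (k : R[i]) : k != 0 -> k * - 'i != 0.
  by move=> k0; rewrite mulf_neq0// oppr_eq0.
have D2 S : S + S = (2 : R[i]) *: S by rewrite scaler_nat mulr2n.
have e1 : (c ^+ 2)%:C *: Q = 1.
  suff -> : (c ^+ 2)%:C *: Q = 1%:C *: I by rewrite scale1r.
  apply: (@selfadj_pseudospectrum_scalar _ _ eps (4 * - 'i)) => //.
  - by apply: NiN; rewrite pnatr_eq0.
  - exact: adj_scale_real.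
  have := phiP 1 1 ('i *: I); rewrite phiQ phi1 diamondT1 diamond_scalar.
  rewrite !circ_star_i ?adj1// !(mul1r, mulr1) !D2 !scalerA => h.
  rewrite [in RHS](_ : 4 * - 'i * 1%:C = - 'i * 2 * 2); last by rewrite mulr1;
    ring.
  by rewrite h; congr (pseudospectrum eps (_ *: _)); rewrite rmorphXn /=; ring.
have e2 : c%:C *: (Q * Q) = 1.
  suff -> : c%:C *: (Q * Q) = 1%:C *: I by rewrite scale1r.
  apply: (@selfadj_pseudospectrum_scalar _ _ eps 4) => //.
  - by rewrite pnatr_eq0.
  - by apply: adj_scale_real; rewrite adjM Qa.
  have := phiP ('i *: I) 1 ('i *: I);
    rewrite phiQ phi1 diamondT1 diamond_scalar.
  rewrite (scalerA 2) !circ_star_i ?adj1// !(mul1r, mulr1) !D2 !scalerA => h.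
  have ii (a : R[i]) : - 'i * (a * 'i) = a
    by rewrite mulNr mulrCA mulCii mulrN1 opprK.
  rewrite [in RHS](_ : 4 * 1%:C = - 'i * (2 * 'i) * 2);
    last by rewrite ii mulr1; ring.
  by rewrite h ii; congr (pseudospectrum eps (_ *: _)); ring.
have [x0 x00] := nontrivial.
have c3 : c ^+ 3 = 1.
  have := congr1 (fun T : bop H => T * T) e1.
  rewrite mul1r bop_scaleAl bop_scaleAr scalerA.
  rewrite -[_ * _](_ : (c ^+ 3)%:C * c%:C = _); last by rewrite -!rmorphM /=;
    congr _%:C; ring.
  rewrite -scalerA e2 => /(congr1 (fun T : bop H => T x0)) /= /eqP.
  rewrite -subr_eq0 -[X in _ - X]scale1r -scalerBl scaler_eq0 (negPf x00) orbF.
  by rewrite subr_eq0 => /eqP[].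
have c1 : c = 1.
  have := sqr_ge0 (2 * c + 1);
    have : (c - 1) * (c ^+ 2 + c + 1) = 0 by ring: c3.
  move=> /eqP; rewrite mulf_eq0 subr_eq0 => /orP[/eqP//|/eqP]; lra.
by move: e1 phi1; rewrite phiQ c1 expr1n !scale1r => -> ->.
Qed.

End Normalization.

(** * Preservation of products, self-adjointness and projections *)

Section Forward.
Variables (R : realType) (H : hilbertType R) (eps : R) (phi psi : bop H -> bop H).
Hypothesis eps0 : 0 <= eps.
Hypothesis orth : forall y : H, exists2 u : H, u != 0 & hdot u y = 0.
Hypothesis psiK : cancel psi phi.
Hypothesis phiP : preserves_triple eps phi.
Local Notation I := (1 : bop H).
Hypotheses (phi1 : phi I = I) (phi_i : phi ('i *: I) = 'i *: I).
Implicit Types (x y z : H) (S T X Y P : bop H).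

Let N2 : (2 : R[i]) != 0. Proof. by rewrite pnatr_eq0. Qed.
Let Ni : ('i : R[i]) != 0. Proof. exact: neq0Ci. Qed.
Let Ni2 : - 'i * 2 != 0 :> R[i].
Proof. by rewrite mulf_neq0// oppr_eq0. Qed.

Lemma diamond_selfadj S T : adj S = S -> adj T = T -> diamond S T = S * T + T * S.
Proof. by rewrite /diamond => _ ->. Qed.

Lemma adj_diamond_selfadj S T : adj S = S -> adj T = T ->
  adj (diamond S T) = diamond S T.
Proof. by move=> Sa Ta; rewrite diamond_selfadj// adjD !adjM Sa Ta addrC. Qed.

(** The third argument is ['i *: I], which [phi] fixes; [circ_star] with it is multiplication by
    [- 'i * 2]. *)
Lemma preserves_diamond S T :
  pseudospectrum eps ((- 'i * 2) *: diamond S T) =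
  pseudospectrum eps ((- 'i * 2) *: diamond (phi S) (phi T)).
Proof.
have E D : circ_star D ('i *: I) = (- 'i * 2) *: D.
  rewrite -[in LHS](scale1r D) circ_star_i ?adj1// !(mul1r, mulr1) -mulr2n.
  by rewrite -(scaler_nat 2 D) scalerA.
by rewrite -!E -{2}phi_i phiP.
Qed.

Lemma preserves_circ_star S T :
  pseudospectrum eps (2 *: circ_star S T) =
  pseudospectrum eps (2 *: circ_star (phi S) (phi T)).
Proof.
have E X Y : circ_star (diamond X 1) Y = 2 *: circ_star X Y.
  by rewrite diamondT1 /circ_star bop_scaleAl bop_scaleAr scalerBr.
by rewrite -!E -phi1 phiP !phi1.
Qed.

(** [circ_star 1 S] is [adj S - S], which vanishes exactly for self-adjoint [S]. *)
Lemma preserves_selfadj S : adj S = S -> adj (phi S) = phi S.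
Proof.
move=> Sa; apply/eqP; rewrite -subr_eq0; apply/eqP.
have := preserves_circ_star 1 S;
  rewrite phi1 /circ_star !(mul1r, mulr1) Sa subrr scaler0.
rewrite (sub_swap_i (adj (phi S))) scalerA => h; symmetry in h.
rewrite (selfadj_pseudospectrum0 eps0 _ _ h) ?scaler0//.
  by rewrite mulf_neq0// oppr_eq0.
by rewrite adjZ adjB adjK conjCi scaleNr -scalerN opprB.
Qed.

Lemma preserves_diamond0 S T : adj S = S -> adj T = T -> diamond S T = 0 ->
  diamond (phi S) (phi T) = 0.
Proof.
move=> Sa Ta ST; apply: (selfadj_pseudospectrum0 eps0 Ni2).
  by apply: adj_diamond_selfadj; apply: preserves_selfadj.
by rewrite -preserves_diamond ST scaler0.
Qed.

Lemma preserves0 : phi 0 = 0.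
Proof.
have := preserves_diamond0 (adj0 _) (adj1 _) (_ : diamond 0 1 = 0).
rewrite phi1 !diamondT1 scaler0 => /(_ erefl) /eqP.
by rewrite scaler_eq0 (negPf N2) => /eqP.
Qed.

(** [T] diamond [T] equals [T] diamond 1. Taking for the third argument the preimage of
    ['i *: rank1 y y] compares [phi T * phi T] and [phi T] through symmetric rank two operators,
    giving equal quadratic forms at each unit [y]. *)
Lemma preserves_idem T : adj T = T -> T * T = T -> phi T * phi T = phi T.
Proof.
move=> Ta TT; have Ta' := preserves_selfadj Ta.
apply: selfadj_inj_unit => // [|y y1]; first by rewrite adjM Ta'.
have DT : diamond T T = diamond T 1
  by rewrite diamond_selfadj// TT diamondT1 scaler_nat mulr2n.
have := phiP T T (psi ('i *: rank1 y y)); rewrite DT phiP phi1 psiK => h.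
have E X : adj X = X -> circ_star (2 *: X) ('i *: rank1 y y) =
    (- 'i * 2) *: sym_rank2 (X y) y.
  move=> Xa; rewrite circ_star_i ?adj_rank1// selfadj_rank1_comm//.
have D2 S : S + S = 2 *: S by rewrite scaler_nat mulr2n.
move: h; rewrite diamondT1 diamond_selfadj// D2.
rewrite !E ?adjM ?Ta'//.
by case/(sym_rank2_pseudospectrum eps0 Ni2 y1 y1 (orth y) (orth y)).
Qed.

End Forward.

(** * Images of rank one projections *)

Section RankOneImage.
Variables (R : realType) (H : hilbertType R) (eps : R) (phi psi : bop H -> bop H).
Hypothesis eps0 : 0 <= eps.
Hypothesis orth : forall y : H, exists2 u : H, u != 0 & hdot u y = 0.
Hypotheses (phiK : cancel phi psi) (psiK : cancel psi phi).
Hypotheses (phiP : preserves_triple eps phi) (psiP : preserves_triple eps psi).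
Local Notation I := (1 : bop H).
Hypotheses (phi1 : phi I = I) (phi_i : phi ('i *: I) = 'i *: I).
Hypotheses (psi1 : psi I = I) (psi_i : psi ('i *: I) = 'i *: I).
Implicit Types (x y z : H) (S T X Y P : bop H).

Lemma idem_neq0_unit P : P * P = P -> P <> 0 -> exists2 y, nsq y = 1 & P y = y.
Proof.
move=> PP P0; have [x Px] : exists x, P x != 0.
  apply: contrapT => no; apply: P0; apply: bopP => x /=.
  by apply/eqP/negPn/negP => Px; apply: no; exists x.
have [k k0 k1] := normalize Px; exists (k%:C *: P x) => //.
by rewrite bopZ; congr (_ *: _); exact: (congr1 (fun T : bop H => T x) PP).
Qed.

(** [phi P] is a nonzero projection, so it fixes some unit vector [y]. The preimage [E] of
    [rank1 y y] is a nonzero projection that kills everything orthogonal to [x], which forces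
    [E = P]. *)
Lemma preserves_rank1 x : nsq x = 1 ->
  exists2 y, nsq y = 1 & phi (rank1 x x) = rank1 y y.
Proof.
move=> x1; set P := rank1 x x.
have Pa : adj P = P by exact: adj_rank1.
have P'a := preserves_selfadj eps0 phiP phi1 Pa.
have P'P' := preserves_idem eps0 orth psiK phiP phi1 Pa (rank1_idem x1).
have [y y1 Py] : exists2 y, nsq y = 1 & phi P y = y.
  apply: idem_neq0_unit => // P'0; have := congr1 psi P'0.
  rewrite phiK (preserves0 eps0 psiP psi1 psi_i) => /(congr1 (fun T : bop H => T x)).
  by rewrite /P rank1_self// => x0; move: x1; rewrite x0 nsq0 => /eqP;
    rewrite eq_sym oner_eq0.
exists y => //; set Q := rank1 y y; set E := psi Q.
have Qa : adj Q = Q by exact: adj_rank1.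
have Ea : adj E = E := preserves_selfadj eps0 psiP psi1 Qa.
have EE : E * E = E := preserves_idem eps0 orth phiK psiP psi1 Qa (rank1_idem y1).
have Q0 : Q <> 0.
  move=> /(congr1 (fun T : bop H => T y)); rewrite /Q rank1_self// => y0.
  by move: y1; rewrite y0 nsq0 => /eqP; rewrite eq_sym oner_eq0.
have E0 : E <> 0.
  by move=> /(congr1 phi); rewrite psiK (preserves0 eps0 phiP phi1 phi_i).
(* Orthogonality is carried forth and back: [rank1 w w] is orthogonal to [P], so its image kills
   [y], hence is orthogonal to [Q], and applying [psi] gives [E * rank1 w w = 0]. *)
have Ew w : hdot w x = 0 -> E w = 0.
  move=> wx; set S := rank1 w w; have Sa : adj S = S by exact: adj_rank1.
  have S'a := preserves_selfadj eps0 phiP phi1 Sa.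
  have SP : diamond S P = 0.
    rewrite diamond_selfadj// /S /P !mul_rank1l; apply: bopP => v /=.
    by rewrite wx (hdotC x w) wx conjC0 !scale0r !scaler0 addr0.
  have := preserves_diamond0 eps0 phiP phi1 phi_i Sa Pa SP.
  rewrite diamond_selfadj// => /(anticommute_idem P'P')[S'P' _].
  have S'y : phi S y = 0 by have := congr1 (fun T : bop H => T y) S'P';
    rewrite /= Py.
  have S'Q : diamond (phi S) Q = 0.
    rewrite diamond_selfadj// selfadj_rank1_comm// S'y.
    by apply: bopP => v /=; rewrite hdot0r scaler0 scale0r addr0.
  have := preserves_diamond0 eps0 psiP psi1 psi_i S'a Qa S'Q.
  rewrite phiK -/E diamond_selfadj// => /(anticommute_idem EE)[_].
  rewrite /S mul_rank1l => /(congr1 (fun T : bop H => T w)) /= /eqP.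
  rewrite scaler_eq0 => /orP[|/eqP//]; rewrite nsqE => /eqP[] /nsq_eq0 ->.
  by rewrite bop_0.
suff -> : P = E by rewrite psiK.
have Ez z : E z = hdot z x *: E x.
  rewrite -{1}(subrK (hdot z x *: x) z) bopD bopZ Ew ?add0r//.
  exact: hdot_proj_orth.
have Ex : E x = hdot (E x) x *: x.
  by apply: hdot_inj => z;
    rewrite adjP Ea Ez hdotZr hdotZl -hdotC -{1}Ea -adjP mulrC.
move: (hdot (E x) x) Ex => a Ex.
have a1 : a = 1.
  have a0 : a != 0.
    apply/eqP => a0; apply: E0; apply: bopP => z.
    by rewrite Ez Ex a0 scale0r scaler0.
  have /(congr1 (fun T : bop H => T x)) := EE; rewrite /= Ex bopZ Ex => /eqP.
  rewrite -subr_eq0 -scalerBr scaler_eq0 (negPf a0) /= -{2}(scale1r x) -scalerBl.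
  rewrite scaler_eq0 subr_eq0 => /orP[/eqP//|/eqP x0].
  by move: x1; rewrite x0 nsq0 => /eqP; rewrite eq_sym oner_eq0.
by apply: bopP => z; rewrite Ez Ex a1 scale1r.
Qed.

End RankOneImage.

(** * Recovery of the quadratic form and of the unitary *)

Section Recovery.
Variables (R : realType) (H : hilbertType R) (eps : R) (phi psi : bop H -> bop H).
Hypothesis eps0 : 0 <= eps.
Hypothesis orth : forall y : H, exists2 u : H, u != 0 & hdot u y = 0.
Hypotheses (phiK : cancel phi psi) (psiK : cancel psi phi).
Hypotheses (phiP : preserves_triple eps phi) (psiP : preserves_triple eps psi).
Local Notation I := (1 : bop H).
Hypotheses (phi1 : phi I = I) (phi_i : phi ('i *: I) = 'i *: I).
Hypotheses (psi1 : psi I = I) (psi_i : psi ('i *: I) = 'i *: I).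
Implicit Types (x y z : H) (S T X Y P : bop H).

Let N2 : (2 : R[i]) != 0. Proof. by rewrite pnatr_eq0. Qed.
Let Ni : ('i : R[i]) != 0. Proof. exact: neq0Ci. Qed.
Let Ni2 : - 'i * 2 != 0 :> R[i].
Proof. by rewrite mulf_neq0// oppr_eq0. Qed.

(** A relation and not a function, because [y] is determined by [x] only up to a unimodular
    factor. *)
Definition linked x y :=
  [/\ nsq x = 1, nsq y = 1 & phi (rank1 x x) = rank1 y y].

Lemma linked_of_l x : nsq x = 1 -> exists y, linked x y.
Proof.
move=> x1; have [y y1 xy] :=
  preserves_rank1 eps0 orth phiK psiK phiP psiP phi1 phi_i psi1 psi_i x1.
by exists y.
Qed.

Lemma linked_of_r y : nsq y = 1 -> exists x, linked x y.
Proof.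
move=> y1; have [x x1 xy] :=
  preserves_rank1 eps0 orth psiK phiK psiP phiP psi1 psi_i phi1 phi_i y1.
by exists x; split=> //; rewrite -xy psiK.
Qed.

(** These are the two invariants of [sym_rank2 ('i *: S x) x], which is [circ_star (rank1 x x) S] up
    to a factor. *)
Lemma linked_invariants S x y : linked x y ->
  rdot (S x) ('i *: x) = rdot (phi S y) ('i *: y) /\
  nsq (S x) - rdot (S x) x ^+ 2 = nsq (phi S y) - rdot (phi S y) y ^+ 2.
Proof.
move=> [x1 y1 xy]; have := preserves_circ_star phiP phi1 (rank1 x x) S.
rewrite xy !circ_star_rank1 !scalerA => h.
have N2i : 2 * 'i != 0 :> R[i] by rewrite mulf_neq0.
have [] := sym_rank2_pseudospectrum eps0 N2i x1 y1 (orth x) (orth y) h.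
have ni v : nsq ('i *: v : H) = nsq v by exact: rdot_i.
by rewrite !rdot_i !ni !rdot_iC => /oppr_inj.
Qed.

Lemma linked_selfadj S x y : adj S = S -> linked x y ->
  rdot (S x) x = rdot (phi S y) y.
Proof.
move=> Sa [x1 y1 xy]; have Sa' := preserves_selfadj eps0 phiP phi1 Sa.
have := preserves_diamond phiP phi_i S (rank1 x x).
rewrite xy !diamond_selfadj ?adj_rank1// !selfadj_rank1_comm// => h.
by case: (sym_rank2_pseudospectrum eps0 Ni2 x1 y1 (orth x) (orth y) h).
Qed.

Lemma nsq_rank1 x v : nsq x = 1 -> nsq (rank1 x x v) = rdot (rank1 x x v) v.
Proof.
move=> x1; have e : rank1 x x (rank1 x x v) = rank1 x x v.
  by rewrite /= hdotZl nsqE x1 mulr1.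
by rewrite -[in RHS]e [RHS]rdot_adj adj_rank1.
Qed.

(* [A] is the real part of [phi (i P)]; equality in Cauchy-Schwarz makes every
   unit vector an eigenvector of [A]. *)
Lemma linked_i_rank1_shift x y : linked x y ->
  exists c : R, phi ('i *: rank1 x x) = c%:C *: I + 'i *: rank1 y y.
Proof.
move=> xy; have [x1 y1 PP'] := xy; set P := rank1 x x in PP' *;
  set P' := rank1 y y in PP' *.
have Pa : adj P = P by exact: adj_rank1.
have P'a : adj P' = P' by exact: adj_rank1.
set Y := phi _; pose A := Y - 'i *: P'.
have YE : Y = A + 'i *: P' by rewrite subrK.
have inv v : nsq v = 1 -> rdot (Y v) ('i *: v) = rdot (P' v) v /\
    nsq (Y v) - rdot (Y v) v ^+ 2 = nsq (P' v).
  move=> /linked_of_r[u uv]; have [u1 v1 _] := uv.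
  have [<- <-] := linked_invariants ('i *: P) uv.
  have := linked_selfadj Pa uv; rewrite PP' => h.
  have -> : ('i *: P) u = 'i *: P u by [].
  rewrite rdot_i rdot_iC selfadj_rdot_i// h oppr0 expr0n subr0; split=> //.
  by rewrite [LHS]rdot_i -/(nsq _) /P /P' !nsq_rank1.
have Aa : adj A = A.
  apply: selfadj_rdot_i_eq0 => v v1; have [h _] := inv v v1.
  have -> : A v = Y v - 'i *: P' v by [].
  by rewrite rdotDl rdotNl h rdot_i subrr.
(* Commutation makes [A * P'] self-adjoint, which removes the cross term [rdot (A v) ('i *: P' v)]
   from [nsq (Y v)]. *)
have AP' : A * P' = P' * A.
  have : circ_star ('i *: P) P = 0.
    by rewrite /circ_star Pa bop_scaleAl bop_scaleAr subrr.
  have := preserves_circ_star phiP phi1 ('i *: P) P => /[swap] ->.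
  rewrite PP' -/Y /circ_star P'a YE mulrDl mulrDr bop_scaleAl bop_scaleAr.
  rewrite opprD addrACA subrr addr0 scaler0 sub_swap_i scalerA => h;
    symmetry in h.
  apply/eqP; rewrite -subr_eq0; apply/eqP.
  have iA : adj ('i *: (A * P' - P' * A)) = 'i *: (A * P' - P' * A).
    by rewrite adjZ adjB !adjM Aa P'a conjCi scaleNr -scalerN opprB.
  have N2i : 2 * - 'i != 0 :> R[i] by rewrite mulf_neq0// oppr_eq0.
  have /eqP := selfadj_pseudospectrum0 eps0 N2i iA h.
  by rewrite scaler_eq0 (negPf Ni) => /eqP.
have nontriv : exists u : H, u != 0 by have [u] := orth 0; exists u.
have [c cA] : exists c : R, A = c%:C *: I.
  apply: (selfadj_eigen_scalar nontriv Aa) => v v1.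
  have [_] := inv v v1; rewrite YE;
    have -> : (A + 'i *: P') v = A v + 'i *: P' v by [].
  rewrite nsqD rdotDl [nsq ('i *: _)]rdot_i -/(nsq _).
  rewrite (rdot_iC (P' v)) (selfadj_rdot_i _ P'a) oppr0 addr0.
  have -> : rdot (A v) ('i *: P' v) = 0.
    have AP'a : adj (A * P') = A * P' by rewrite adjM Aa P'a AP'.
    rewrite -bopZ -{1}P'a -rdot_adj -[P' (A v)]/((P' * A) v) -AP'.
    exact: selfadj_rdot_i.
  move=> h; apply/eqP; rewrite -subr_eq0; apply/eqP/nsq_eq0.
  by rewrite nsqB nsqZr rdotZr v1; lra.
by exists c; rewrite YE cA.
Qed.

Lemma linked_orthogonal x y u v : linked x y -> linked u v -> hdot u x = 0 ->
  rank1 v v * rank1 y y = 0 /\ rank1 y y * rank1 v v = 0.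
Proof.
move=> [x1 y1 xy] [u1 v1 uv] ux.
have D0 : diamond (rank1 u u) (rank1 x x) = 0.
  rewrite diamond_selfadj ?adj_rank1// !mul_rank1l; apply: bopP => w /=.
  by rewrite ux (hdotC x u) ux conjC0 !scale0r !scaler0 addr0.
have := preserves_diamond0 eps0 phiP phi1 phi_i (adj_rank1 u u) (adj_rank1 x x) D0.
rewrite uv xy diamond_selfadj ?adj_rank1//.
exact: anticommute_idem (rank1_idem y1).
Qed.

(** For [u] orthogonal to [x] and linked to [v], [circ_star] of the two multiplied projections is
    zero, whereas for their images it is [- 'i * 2 * c] times [rank1 v v]; hence the shift [c] is
    zero. *)
Lemma linked_i_rank1 x y : linked x y -> phi ('i *: rank1 x x) = 'i *: rank1 y y.
Proof.
move=> xy; have [c Yc] := linked_i_rank1_shift xy.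
suff -> : phi ('i *: rank1 x x) = 0%:C *: I + 'i *: rank1 y y
  by rewrite scale0r add0r.
rewrite Yc; congr (_%:C *: _ + _).
have [u0 u00 u0x] := orth x; have [k k0 u1] := normalize u00.
set u := k%:C *: u0 in u1; have ux : hdot u x = 0 by rewrite hdotZl u0x mulr0.
have [v uv] := linked_of_l u1; have [d Zd] := linked_i_rank1_shift uv.
have [vy yv] := linked_orthogonal xy uv ux; have [_ v1 _] := uv.
have C0 : circ_star ('i *: rank1 x x) ('i *: rank1 u u) = 0.
  rewrite circ_star_i ?adj_rank1// !mul_rank1l [X in _ *: X](_ : _ = 0) ?scaler0//.
  by apply: bopP => w /=;
    rewrite ux (hdotC x u) ux conjC0 !scale0r !scaler0 addr0.
have C' : circ_star (phi ('i *: rank1 x x)) (phi ('i *: rank1 u u)) =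
    (- 'i * 2) *: (c%:C *: rank1 v v).
  rewrite Yc Zd /circ_star adjD adj_scale_real ?adj1// adjZ adj_rank1 conjCi.
  rewrite !(mulrDl, mulrDr, bop_scaleAl, bop_scaleAr, mulr1, mul1r) vy yv.
  rewrite !(scaler0, addr0) !scaleNr -!scalerN !scalerA.
  rewrite scalerN (mulrC d%:C c%:C) (mulrC 'i) (mulrC 'i) (addrAC (_ *: I)) opprD addrACA subrr.
  by rewrite add0r mulrDl !mulNr scalerDl !scaleNr (mulrC 'i).
have := preserves_circ_star phiP phi1 ('i *: rank1 x x) ('i *: rank1 u u).
rewrite C0 C' scaler0 scalerA => h; symmetry in h.
have N2i2 : 2 * (- 'i * 2) != 0 :> R[i] by rewrite mulf_neq0.
have e := selfadj_pseudospectrum0 eps0 N2i2 (adj_scale_real c (adj_rank1 v v)) h.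
have := congr1 (fun T : bop H => T v) e; rewrite /= nsqE v1 scale1r => /eqP.
rewrite scaler_eq0.
case/orP => [/eqP[]//|/eqP v0].
by move: v1; rewrite v0 nsq0 => /eqP; rewrite eq_sym oner_eq0.
Qed.

(** After rotation by [u = |a| / a] the left operator is self-adjoint with top [|a|], while the
    right one has numerical range of real part at most the maximum [m] of [Re (u b)] and 0. Since
    [|a| > 0], this gives [|a| <= Re (u b) <= |b|]. *)
Lemma rank1_scale_pseudospectrum_le x y (a b : R[i]) : nsq x = 1 -> nsq y = 1 ->
  pseudospectrum eps (a *: rank1 x x) = pseudospectrum eps (b *: rank1 y y) ->
  a != 0 -> `|a| <= `|b| /\ complex.Re `|a| <= complex.Re (`|a| / a * b).
Proof.
move=> x1 y1 ab a0; set u := `|a| / a.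
have u1 : `|u| = 1 by rewrite normf_div normr_id mulfV// normr_eq0.
have := pseudospectrum_eqZ u1 ab; rewrite !scalerA divfK//.
have : 0 < `|a| by rewrite normr_gt0.
case aE: `|a| => [k ki]; rewrite ltcE /= => /andP[/eqP ki0 k0].
rewrite ki0 -/(k%:C) => h.
pose m := Num.max (complex.Re (u * b)) 0.
have bm : rdot_le ((u * b) *: rank1 y y) m.
  move=> v /=.
  have -> : rdot ((u * b) *: (hdot v y *: y)) v =
      complex.Re (u * b) * (rdot v y ^+ 2 + rdot v ('i *: y) ^+ 2).
    have <- : complex.Im (hdot v y) = rdot v ('i *: y) by rewrite hdot_rdot.
    rewrite {1}/rdot hdotZl (mulrC (u * b)) hdotZl (hdotC y v) -normCK -add_Re2_Im2 ReZ.
    by rewrite mulrC.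
  apply: (@le_trans _ _ (m * (rdot v y ^+ 2 + rdot v ('i *: y) ^+ 2))).
    by rewrite ler_wpM2r ?addr_ge0 ?sqr_ge0// le_max lexx.
  rewrite ler_wpM2l ?le_max ?lexx ?orbT//.
  by have := hdot_cauchy_schwarz v y; rewrite y1 mulr1.
have am : rdot_le (k%:C *: rank1 x x) m.
  apply: (rdot_le_pseudospectrum _ eps0) => [|l].
    exact: adj_scale_real (adj_rank1 x x).
  by rewrite h; apply: pseudospectrum_Re_le.
have km : k <= m.
  have := am x; rewrite /= nsqE x1 scale1r.
  by rewrite rdotZl -/(nsq x) x1 !mulr1.
have kRe : k <= complex.Re (u * b).
  by move: km; rewrite /m le_max => /orP[//|]; rewrite leNgt k0.
split=> //.
have -> : `|b| = `|u * b| by rewrite normrM u1 mul1r.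
rewrite normc_def -/(k%:C) lecR; apply: le_trans kRe _.
apply: le_trans (ler_norm _) _.
by rewrite -sqrtr_sqr ler_sqrt ?addr_ge0 ?sqr_ge0// lerDl sqr_ge0.
Qed.

(** By symmetry the moduli agree, so [w] has modulus [|a|] and real part at least [|a|]; this leaves
    only [w = |a|]. *)
Lemma rank1_scale_pseudospectrum x y (a b : R[i]) : nsq x = 1 -> nsq y = 1 ->
  pseudospectrum eps (a *: rank1 x x) = pseudospectrum eps (b *: rank1 y y) -> a = b.
Proof.
move=> x1 y1 ab.
have [a0|a0] := eqVneq a 0; have [b0|b0] := eqVneq b 0.
- by rewrite a0 b0.
- have [+ _] := rank1_scale_pseudospectrum_le y1 x1 (esym ab) b0.
  by rewrite a0 normr0 normr_le0 (negPf b0).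
- have [+ _] := rank1_scale_pseudospectrum_le x1 y1 ab a0.
  by rewrite b0 normr0 normr_le0 (negPf a0).
have [abn Re_ab] := rank1_scale_pseudospectrum_le x1 y1 ab a0.
have [ban _] := rank1_scale_pseudospectrum_le y1 x1 (esym ab) b0.
have nab : `|b| = `|a| by apply/eqP; rewrite eq_le ban.
set w := `|a| / a * b in Re_ab.
have na0 : `|a| != 0 by rewrite normr_eq0.
have wn : `|w| = `|a|.
  by rewrite /w normrM normf_div normr_id divff// mul1r.
suff wa : w = `|a|.
  have : `|a| * (b / a) = `|a| * 1 by rewrite mulr1 -[RHS]wa /w; ring.
  by move=> /(mulfI na0) /(canRL (divfK a0)); rewrite mul1r.
have := add_Re2_Im2 w; rewrite wn.
have := normr_ge0 a; move: Re_ab; case: `|a| => k ki /= kw.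
rewrite lecE /= => /andP[/eqP -> k0].
case: w {wn} kw => c d /= kc; rewrite expr2 => -[].
rewrite mul0r subr0 => kcd _.
have d0 : d = 0 by apply/eqP; rewrite -sqrf_eq0; apply/eqP; have := sqr_ge0 d;
  nra.
apply/eqP; rewrite eq_complex /= d0 eqxx andbT; apply/eqP; nra.
Qed.

(* The factor [2 P - 1] cancels all matrix entries of [S] outside the range
   of [P]. *)
Lemma triple_compression S x : nsq x = 1 ->
  circ_star (diamond S (2%:C *: rank1 x x - I)) ('i *: rank1 x x) =
  (- 'i * 4 * hdot (S x) x) *: rank1 x x.
Proof.
move=> x1; set P := rank1 x x; set K := _ - I.
have Pa : adj P = P by exact: adj_rank1.
have Ka : adj K = K by rewrite adjB adj1 adj_scale_real.
have PP : P * P = P by exact: rank1_idem.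
have two T : 2%:C *: T = T + T by rewrite rmorph_nat scaler_nat mulr2n.
have KP : K * P = P by rewrite mulrBl mul1r bop_scaleAl PP two addrK.
have PK : P * K = P by rewrite mulrBr mulr1 bop_scaleAr PP two addrK.
have PSP : P * S * P = hdot (S x) x *: P.
  by apply: bopP => v; rewrite /= bopZ hdotZl !scalerA mulrC.
have KSP : K * S * P = P * S * P + P * S * P - S * P.
  by rewrite !mulrBl mul1r !bop_scaleAl two.
have PSK : P * S * K = P * S * P + P * S * P - P * S.
  by rewrite mulrBr mulr1 bop_scaleAr two.
clearbody K.
have core : diamond S K * P + P * diamond S K = P * S * P *+ 4.
  rewrite /diamond Ka mulrDl mulrDr -(mulrA S) KP KSP !mulrA PSK PK.
  rewrite addrC (addrC (S * P)) !subrK.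
  by rewrite -mulr2n -mulr2n -mulrnA.
rewrite -[diamond _ _]scale1r circ_star_i// mulr1 core PSP -scaler_nat.
by rewrite !scalerA.
Qed.

(** Once [phi] is known to send [2 P - 1] to [2 P' - 1], [triple_compression] on both sides leaves
    scalar multiples of [P] and [P'] with equal pseudospectra, so the scalars agree. *)
Lemma linked_hdot S x y : linked x y -> hdot (S x) x = hdot (phi S y) y.
Proof.
move=> xy; have [x1 y1 PP'] := xy.
have KE : phi (2%:C *: rank1 x x - I) = 2%:C *: rank1 y y - I.
  have Ka u : adj (2%:C *: rank1 u u - I) = 2%:C *: rank1 u u - I.
    by rewrite adjB adj1 adj_scale_real// adj_rank1.
  apply: (selfadj_inj_unit (preserves_selfadj eps0 phiP phi1 (Ka x)) (Ka y)) => v v1.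
  have [u uv] := linked_of_r v1; have [u1 _ _] := uv.
  rewrite -(linked_selfadj (Ka x) uv).
  have Kr w z : rdot ((2%:C *: rank1 w w - I) z) z = 2 * rdot (rank1 w w z) z - nsq z.
    by rewrite -rdotZl -rdotNl -rdotDl.
  by rewrite !Kr u1 v1 (linked_selfadj (adj_rank1 x x) uv) PP'.
have := phiP S (2%:C *: rank1 x x - I) ('i *: rank1 x x).
rewrite KE (linked_i_rank1 xy) !triple_compression// => /(rank1_scale_pseudospectrum x1 y1).
by apply: mulfI; rewrite mulf_neq0 ?oppr_eq0// pnatr_eq0.
Qed.

(** Every unit [y] is linked to some [x]. Together with [linked_hdot] this reduces algebraic
    identities for [phi] to identities between quadratic forms at [x]. *)
Lemma linked_ext S T : (forall x y, linked x y -> hdot (phi S y) y = hdot (T y) y) ->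
  phi S = T.
Proof.
move=> ST; apply: bop_inj_unit => y y1; have [x xy] := linked_of_r y1.
exact: ST xy.
Qed.

Lemma preserver_linear : linear phi.
Proof.
move=> a S T; apply: linked_ext => x y xy; rewrite -(linked_hdot _ xy) /=.
by rewrite !hdotDl !hdotZl !(linked_hdot _ xy).
Qed.

Lemma preserver_adj S : phi (adj S) = adj (phi S).
Proof.
apply: linked_ext => x y xy; rewrite -(linked_hdot _ xy).
by rewrite hdotC -adjP (linked_hdot _ xy) adjP -hdotC.
Qed.

Lemma linked_nsq S x y : linked x y -> nsq (S x) = nsq (phi S y).
Proof.
move=> xy; have [_] := linked_invariants S xy.
have -> : rdot (phi S y) y = rdot (S x) x by rewrite /rdot (linked_hdot S xy).
lra.
Qed.

(** Polarizing [linked_nsq] in the operator variable shows that inner products [hdot (A x) (B x)]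
    are preserved. The form of [adj S * T] at [x] is such a product, so the first factor is written
    as an adjoint. *)
Lemma preserver_mul S T : phi (S * T) = phi S * phi T.
Proof.
have phiD (A B : bop H) : phi (A + B) = phi A + phi B.
  by have := preserver_linear 1 A B; rewrite !scale1r.
have phi0 : phi 0 = 0 := preserves0 eps0 phiP phi1 phi_i.
have phiZ a (A : bop H) : phi (a *: A) = a *: phi A.
  by have := preserver_linear a A 0; rewrite phi0 !addr0.
rewrite -(adjK S) preserver_adj; move: (adj S) => {}S.
apply: linked_ext => x y xy; rewrite -(linked_hdot _ xy) /=.
have Sr (A B : bop H) : rdot (A x) (B x) = rdot (phi A y) (phi B y).
  have := linked_nsq (A + B) xy; rewrite phiD /= !nsqD.
  by rewrite -!(linked_nsq _ xy); lra.
rewrite [LHS]hdotC [RHS]hdotC -!adjP !hdot_rdot;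
  congr (Num.conj (Complex _ _)) => //.
have := Sr S ('i *: T); rewrite phiZ; exact.
Qed.

(** With [e] linked to [f], the map [U x = phi (rank1 x e) f] is isometric by [linked_nsq] and
    intertwines [S] with [phi S] by multiplicativity. It sends [e] to [f], so [psi (rank1 y f) e] is
    a preimage of [y]. *)
Lemma preserver_unitary :
  exists2 U : bop H, unitary U & forall T, phi T = U * T * adj U.
Proof.
have [e0 e00 _] := orth 0; have [k k0 e1] := normalize e00.
set e := k%:C *: e0 in e1; have [f ef] := linked_of_l e1; have [_ f1 PP'] := ef.
pose u x := phi (rank1 x e) f.
have un x : nsq (u x) = nsq x.
  by rewrite /u -(linked_nsq _ ef) /= nsqE e1 scale1r.
have uL : linear u.
  move=> a x y; rewrite /u rank1Dl rank1Zl preserver_linear.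
  by [].
have uB : bounded_map u.
  by apply: (@nsq_bounded _ _ _ 1) => // x; rewrite un mul1r.
pose U : bop H := Bop _ uL uB.
have US S x : U (S x) = phi S (U x).
  by rewrite /= /u -mul_rank1l preserver_mul.
have Usurj y : exists x, U x = y.
  exists (psi (rank1 y f) e); rewrite (US (psi (rank1 y f)) e) psiK /=.
  by rewrite /u PP' rank1_self// nsqE f1 scale1r.
have UV : adj U * U = 1.
  by apply: bop_inj => x; rewrite [LHS]hdotC -adjP -hdotC !nsqE un.
have VU : U * adj U = 1.
  apply: bopP => y /=; have [x <-] := Usurj y; congr (U _).
  exact: (congr1 (fun T : bop H => T x) UV).
exists U => // T; have UT : U * T = phi T * U by apply: bopP => x; exact: US.
by rewrite UT -mulrA VU mulr1.
Qed.

End Recovery.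

Theorem theorem2p2 (R : realType) (H : hilbertType R)
    (B : set H) (J : basis_conj B) (eps : R) (phi : bop H -> bop H) :
  infinite_dimensional H ->
  orthonormal_basis B ->
  0 < eps ->
  bijective phi ->
  (forall T1 T2 T3 : bop H,
     pseudospectrum eps (circ_star (diamond T1 T2) T3) =
     pseudospectrum eps (circ_star (diamond (phi T1) (phi T2)) (phi T3))) ->
  adj (phi ('i *: (1 : bop H))) = - phi ('i *: (1 : bop H)) ->
  exists V : bop H, inverse_of (phi 1 * phi 1) V /\
    exists (U : bop H) (l : R[i]), unitary U /\ (l = -1 \/ l = 1) /\
      ((forall T, phi T = l *: (V * U * T * adj U)) \/
       (forall T, phi T = l *: (V * U * transpose J T * adj U))).
Proof.
move=> infH _ /ltW eps0 [psi phiK psiK] phiP phi_ia.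
have orth := exists_orthogonal infH.
have nontriv : exists x : H, x != 0 by have [u] := orth 0; exists u.
have [phi1 phi_i] := phi1_phii eps0 nontriv psiK phiP phi_ia.
(* The inverse map satisfies the same conditions, which lets the results on images be used in both
   directions. *)
have psiP : preserves_triple eps psi by move=> A1 A2 A3; rewrite [RHS]phiP !psiK.
have psi1 : psi 1 = 1 by rewrite -{1}phi1 phiK.
have psi_i : psi ('i *: (1 : bop H)) = 'i *: (1 : bop H) by rewrite -{1}phi_i phiK.
have [U Uu UT] :=
  preserver_unitary eps0 orth phiK psiK phiP psiP phi1 phi_i psi1 psi_i.
exists 1; split; first by rewrite /inverse_of phi1 !mulr1.
exists U, 1; split=> //; split; first by right.
by left=> T; rewrite scale1r mul1r UT.
Qed.
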